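(* Let $X,Y$ be function spaces in the wide sense on $(\Omega,\Sigma,\mu,\Delta_X)$ and $(\Omega,\Sigma,\mu,\Delta_Y)$ respectively, and let $i:X\to Y$ be an absolutely continuous (bounded linear) injection with dense range. If $i(\Delta_X)=\Delta_Y$, i.e. $i(\Delta_X(A,f))=\Delta_Y(A,i(f))$ for all $A\in\Sigma$, $f\in X$, then for all $0<\theta<\beta<1$ the canonical injection $i:(X,Y)_\theta\to(X,Y)_\beta$ is absolutely continuous.
   Context: All Banach spaces are complex; $(\Omega,\Sigma,\mu)$ is a measure space. A Banach space $Y$ is a function space in the wide sense on $(\Omega,\Sigma,\mu,\Delta_Y)$ if $\Delta_Y:\Sigma\times Y\to Y$ satisfies: (I) $\Delta_Y(A\cap B,f)=\Delta_Y(A,\Delta_Y(B,f))$ for all $A,B\in\Sigma$, $f\in Y$; (II) $f\mapsto\Delta_Y(A,f)$ is linear for each $A\in\Sigma$; (III) $\Delta_Y(A\cup B,f)=\Delta_Y(A,f)+\Delta_Y(B,f)$ if $A\cap B=\emptyset$; (IV) $\Delta_Y(A,f)=0$ if $\mu(A)=0$, and $\Delta_Y(\Omega,f)=f$; (V) there is $C>0$ with $\|\Delta_Y(A,f)\|\le C\|f\|$ for all $A,f$. A bounded operator $T:X\to Z$ from a function space in the wide sense $X$ to a Banach space $Z$ is absolutely continuous if for every $\varepsilon>0$ there is $\delta>0$ such that for every $A\in\Sigma$ with $\mu(A)<\delta$, the operator $f\mapsto T(\Delta_X(A,f))$ has norm $<\varepsilon$ in $\mathcal L(X,Z)$. Via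 $i$, $X$ is identified with a subspace of $Y$ and $(X,Y)$ is an interpolation couple with $X+Y=Y$. $(X,Y)_\theta$ is the (first) complex interpolation space: with $S=\{0\le\operatorname{Re}z\le1\}$, $\mathcal F(X,Y)$ is the space of bounded continuous $F:S\to X+Y$, holomorphic in the interior, with $\tau\mapsto F(i\tau)$ continuous into $X$ and $\tau\mapsto F(1+i\tau)$ continuous into $Y$, both tending to $0$ in norm as $|\tau|\to\infty$, normed by $\max(\sup_\tau\|F(i\tau)\|_X,\sup_\tau\|F(1+i\tau)\|_Y)$; $(X,Y)_\theta=\{F(\theta):F\in\mathcal F(X,Y)\}$ with the quotient norm. It is a function space in the wide sense on $(\Omega,\Sigma,\mu,\Delta_\theta)$, where $\Delta_\theta$ is the restriction of $\Delta_Y$ to $\Sigma\times(X,Y)_\theta$. For $\theta<\beta$ one has $(X,Y)_\theta\subset(X,Y)_\beta$ continuously. *)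

(* Defs.v *)
From HB Require Import structures.
From mathcomp Require Import all_boot all_order all_algebra.
From mathcomp Require Import complex.
From mathcomp Require Import all_classical all_reals all_analysis.
Set Implicit Arguments.
Unset Strict Implicit.
Unset Printing Implicit Defensive.

Import Order.TTheory GRing.Theory Num.Theory numFieldNormedType.Exports.
Local Open Scope classical_set_scope.
Local Open Scope ring_scope.
Local Open Scope complex_scope.

Section FunctionSpaces.
Context {R : realType}.

(* The norm of a normed module over R[i] is R[i]-valued (real, nonnegative). *)
Definition rnorm {V : normedModType R[i]} (v : V) : R := complex.Re `|v|.

Record is_function_space {d : measure_display} {T : measurableType d}
    (mu : {measure set T -> \bar R}) (Y : completeNormedModType R[i])
    (Delta : set T -> Y -> Y) : Prop := IsFunctionSpace {
  Delta_setI : forall A B f, measurable A -> measurable B ->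
    Delta (A `&` B) f = Delta A (Delta B f) ;
  Delta_linear : forall A, measurable A -> linear (Delta A) ;
  Delta_setU : forall A B f, measurable A -> measurable B ->
    A `&` B = set0 -> Delta (A `|` B) f = Delta A f + Delta B f ;
  Delta_null : forall A f, measurable A -> mu A = 0%E -> Delta A f = 0 ;
  Delta_setT : forall f, Delta setT f = f ;
  Delta_bounded : exists2 C : R, 0 < C &
    forall A f, measurable A -> rnorm (Delta A f) <= C * rnorm f
}.

(* The data of a normed space carried by a linear subspace of V, such as
   (X,Y)_theta inside Y; subnorm is meaningful on the carrier only. *)
Record normed_subspace (V : lmodType R[i]) := NormedSubspace {
  carrier : set V ;
  subnorm : V -> R
}.

Definition whole (V : normedModType R[i]) : normed_subspace V :=
  NormedSubspace setT rnorm.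

Section Operators.
Context {V W : lmodType R[i]} (E : normed_subspace V) (F : normed_subspace W).

Definition op_norm (T : V -> W) : \bar R :=
  ereal_sup [set (subnorm F (T v))%:E | v in
    [set v | carrier E v /\ subnorm E v <= 1]].

Definition bounded_operator (T : V -> W) : Prop :=
  [/\ forall v, carrier E v -> carrier F (T v),
      forall (a : R[i]) u v, carrier E u -> carrier E v ->
        T (a *: u + v) = a *: T u + T v &
      (op_norm T < +oo)%E].

(* The operator f |-> T (Delta A f) is required to belong to L(E, F), since
   op_norm alone does not see whether the values lie in the carrier of F. *)
Definition absolutely_continuous_op {d : measure_display} {O : measurableType d}
    (mu : {measure set O -> \bar R}) (Delta : set O -> V -> V) (T : V -> W) :=
  bounded_operator T /\
  forall eps : R, 0 < eps -> exists2 delta : R, 0 < delta &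
    forall A, measurable A -> (mu A < delta%:E)%E ->
      bounded_operator (fun f => T (Delta A f)) /\
      (op_norm (fun f => T (Delta A f)) < eps%:E)%E.

End Operators.

Section ComplexInterpolation.
Context {X Y : completeNormedModType R[i]} (i : X -> Y).

Definition strip : set R[i]^o := [set z | 0 <= complex.Re z <= 1].

(* X is identified with the subspace i(X) of Y, so that X + Y = Y. The boundary
   function t |-> F(it), seen in X, is ctrace; as i is injective it is determined
   by cfun. Values of cfun outside the strip play no role. *)
Record calderon := Calderon {
  cfun : R[i]^o -> Y ;
  ctrace : R -> X ;
  cfun_bounded : exists M : R, forall z, strip z -> rnorm (cfun z) <= M ;
  cfun_continuous : {within strip, continuous cfun} ;
  cfun_holomorphic : forall z : R[i]^o, 0 < complex.Re z < 1 ->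
    derivable cfun z 1 ;
  ctraceE : forall t : R, i (ctrace t) = cfun (0 +i* t) ;
  ctrace_continuous : continuous ctrace ;
  ctrace_pinfty : ctrace t @[t --> +oo] --> (0 : X) ;
  ctrace_ninfty : ctrace t @[t --> -oo] --> (0 : X) ;
  cfun1_continuous : continuous (fun t : R => cfun (1 +i* t)) ;
  cfun1_pinfty : cfun (1 +i* t) @[t --> +oo] --> (0 : Y) ;
  cfun1_ninfty : cfun (1 +i* t) @[t --> -oo] --> (0 : Y)
}.

Definition calderon_norm (F : calderon) : R :=
  Num.max (sup [set rnorm (ctrace F t) | t in [set: R]])
          (sup [set rnorm (cfun F (1 +i* t)) | t in [set: R]]).

Definition interpolation_space (theta : R) : normed_subspace Y :=
  NormedSubspace
    [set y | exists F : calderon, cfun F theta%:C = y]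
    (fun y => inf [set calderon_norm F | F in [set F | cfun F theta%:C = y]]).

End ComplexInterpolation.
End FunctionSpaces.

(* Main.v *)
Require Import Defs.
From HB Require Import structures.
From mathcomp Require Import all_boot all_order all_algebra.
From mathcomp Require Import complex.
From mathcomp Require Import all_classical all_reals all_analysis.
From mathcomp Require Import ring lra.
Import Order.TTheory GRing.Theory Num.Theory numFieldNormedType.Exports.
Local Open Scope classical_set_scope.
Local Open Scope ring_scope.
Local Open Scope complex_scope.
(** Put s = theta / beta and let F be in the Calderon space with F(theta) = y.
    For a measurable set A,
      H(z) = ((2 - beta) / (2 - z)) ^ k * Delta_A (F (s z))
    is again in the Calderon space and H(beta) = Delta_A y.  On Re z = 0 its
    X-norm is at most C ((2 - beta) / 2) ^ k |F|, small for large k.  On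
    Re z = 1 one needs Delta_A F to be small on the line Re = s; since it is
    small on Re = 0, by absolute continuity of i, and bounded on Re = 1, this
    is a three lines estimate, for which a crude constant is good enough.

    That estimate comes from Cauchy's formula on the rectangles
    [0, 1] x [-L, L].  All contour integrals are replaced by dyadic Riemann
    sums, for which Goursat's subdivision argument works without convergence
    of the sums and without any continuity of the derivative. *)

(** Absolute continuity makes Delta_A small only as a map from X to Y; in the X-norm Delta_A is
    merely bounded. On Re z = 0 the gain must therefore come from a scalar factor equal to 1 at
    beta, and such a factor exceeds 1 somewhere on Re z = 1. The substitution s z replaces that line
    by the interior line Re = s, to which smallness in Y spreads from Re = 0; this is where theta <
    beta enters, as s < 1. So k is fixed first, and the loss (2 - beta) ^ k is then absorbed by
    taking mu(A) small. The rational factor does the work of exp (k (z - beta)) and also tends to 0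
    at infinity, which supplies the decay required on Re z = 1. Powers of (1 + s) / (1 + z) likewise
    turn a bound by a constant times the sum of the boundary bounds into one that can be made small.
    For the former, Cauchy's formula needs only a lower bound for the contour sum of 1 / (z - s),
    not its value. *)

Set Implicit Arguments.
Unset Strict Implicit.
Unset Printing Implicit Defensive.

(** * Real-valued norms, complex moduli, limits in epsilon form *)

Section RealNorm.
Context {R : realType} {V : normedModType R[i]}.
Implicit Types (u v w : V) (a : R[i]).

Lemma rnormE v : (rnorm v)%:C = `|v|.
Proof. by rewrite /rnorm RRe_real// ger0_real. Qed.

Lemma rnorm_ge0 v : 0 <= rnorm v.
Proof. by rewrite -(@ler0c R) rnormE. Qed.

Lemma rnorm0 : rnorm (0 : V) = 0.
Proof. by rewrite /rnorm normr0. Qed.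

Lemma rnorm_eq0 v : rnorm v = 0 -> v = 0.
Proof. by move=> v0; apply/eqP; rewrite -normr_eq0 -rnormE v0. Qed.

Lemma rnormN v : rnorm (- v) = rnorm v.
Proof. by rewrite /rnorm normrN. Qed.

Lemma rnormD u v : rnorm (u + v) <= rnorm u + rnorm v.
Proof. by rewrite -(@lecR R) rmorphD /= !rnormE ler_normD. Qed.

Lemma rnormB u v : rnorm (u - v) <= rnorm u + rnorm v.
Proof. by rewrite -(rnormN v) rnormD. Qed.

Lemma rdistC u v : rnorm (u - v) = rnorm (v - u).
Proof. by rewrite -opprB rnormN. Qed.

Lemma rnormZ a v : rnorm (a *: v) = rnorm (a : R[i]^o) * rnorm v.
Proof. by apply: (@complexI R); rewrite rmorphM /= !rnormE normrZ. Qed.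

End RealNorm.

Section ComplexModulus.
Context {R : realType}.
Implicit Types (x y : R) (z : R[i]).

Definition cmod z : R := rnorm (z : R[i]^o).

Lemma cmod_sqr z : cmod z ^+ 2 = complex.Re z ^+ 2 + complex.Im z ^+ 2.
Proof. by apply: (@complexI R); rewrite rmorphXn/= rnormE -add_Re2_Im2. Qed.

Lemma cmod_ge0 z : 0 <= cmod z. Proof. exact: rnorm_ge0. Qed.

Lemma cmodM z w : cmod (z * w) = cmod z * cmod w.
Proof. by apply: (@complexI R); rewrite rmorphM /= !rnormE -normrM. Qed.

Lemma cmodV z : cmod z^-1 = (cmod z)^-1.
Proof. by apply: (@complexI R); rewrite fmorphV /= !rnormE -normfV. Qed.

Lemma cmodX z n : cmod (z ^+ n) = cmod z ^+ n.
Proof. by apply: (@complexI R); rewrite rmorphXn /= !rnormE -normrX. Qed.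

Lemma cmod_real x : cmod x%:C = `|x|.
Proof.
apply/eqP; rewrite -(@eqrXn2 _ 2)// ?cmod_ge0// cmod_sqr/= expr0n addr0.
by rewrite real_normK// num_real.
Qed.

Lemma cmodE x y : cmod (x +i* y) ^+ 2 = x ^+ 2 + y ^+ 2.
Proof. exact: cmod_sqr. Qed.

Lemma cmod_imag y : cmod (0 +i* y) = `|y|.
Proof.
apply/eqP; rewrite -(@eqrXn2 _ 2)// ?cmod_ge0// cmodE expr0n add0r.
by rewrite real_normK// num_real.
Qed.

Lemma cmod_leD x y : cmod (x +i* y) <= `|x| + `|y|.
Proof.
rewrite -(@ler_pXn2r _ 2)// ?nnegrE ?cmod_ge0 ?addr_ge0//.
rewrite cmodE sqrrD !real_normK ?num_real// lerD2r lerDl.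
by rewrite mulrn_wge0// mulr_ge0.
Qed.

Lemma cmod_geRe z : `|complex.Re z| <= cmod z.
Proof.
rewrite -(@ler_pXn2r _ 2)// ?nnegrE ?cmod_ge0//.
by rewrite cmod_sqr real_normK ?num_real// lerDl sqr_ge0.
Qed.

Lemma cmod_geIm z : `|complex.Im z| <= cmod z.
Proof.
rewrite -(@ler_pXn2r _ 2)// ?nnegrE ?cmod_ge0//.
by rewrite cmod_sqr real_normK ?num_real// lerDr sqr_ge0.
Qed.

Lemma ImD (u v : R[i]) : complex.Im (u + v) = complex.Im u + complex.Im v.
Proof. by case: u v => [a b] [c d]. Qed.

Lemma addc_imag x y h : (x +i* y) + (0 +i* h) = x +i* (y + h).
Proof. by apply/eqP; rewrite eq_complex /= addr0 !eqxx. Qed.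

Lemma addc_real x y h : (x +i* y) + h%:C = (x + h) +i* y.
Proof. by apply/eqP; rewrite eq_complex /= addr0 !eqxx. Qed.

Lemma complex_half (a b : R) : (a +i* b) / 2 = (a / 2) +i* (b / 2).
Proof.
have n2 : (2 : R[i]) != 0 by rewrite pnatr_eq0.
apply: (mulIf n2); rewrite divfK// mulr_natr mulr2n.
by apply/eqP; rewrite eq_complex/=; apply/andP; split; apply/eqP; field.
Qed.

Lemma imag_half y : (0 +i* y) / 2 = 0 +i* (y / 2) :> R[i].
Proof. by rewrite complex_half mul0r. Qed.

End ComplexModulus.

Section EpsilonDelta.
Context {R : realType} {V : normedModType R[i]}.

Lemma cvg_rnormP {T : Type} (F : set_system T) {FF : Filter F} (f : T -> V) l :
  f x @[x --> F] --> l <->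
  forall e : R, 0 < e -> \forall x \near F, rnorm (f x - l) <= e.
Proof.
split=> [/cvgrPdist_le fl e e0|fl].
  have /fl : 0 < e%:C by rewrite (@ltcR R 0).
  by apply: filterS => x; rewrite -rnormE lecR rdistC.
apply/cvgrPdist_le => e e0; have eE : e = (complex.Re e)%:C.
  by rewrite RRe_real// gtr0_real.
have /fl : 0 < complex.Re e by rewrite -(@ltcR R 0) -eE.
by apply: filterS => x; rewrite -rnormE eE lecR rdistC.
Qed.

Lemma nbhs_rnormP (p : V) (A : set V) :
  nbhs p A <-> exists2 d : R, 0 < d & forall w, rnorm (w - p) < d -> A w.
Proof.
split=> [/nbhs_normP[e /= e0 eA]|[d d0 dA]].
  have eE : e = (complex.Re e)%:C by rewrite RRe_real// gtr0_real.
  exists (complex.Re e); first by rewrite -(@ltcR R 0) -eE.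
  by move=> w wp; apply: eA; rewrite /= -rnormE eE ltcR rdistC.
apply/nbhs_normP; exists d%:C => /=; first by rewrite (@ltcR R 0).
by move=> w /=; rewrite -rnormE ltcR rdistC => /dA.
Qed.

End EpsilonDelta.

(** * Dyadic Riemann sums along edges and around rectangles *)

Section EdgeSums.
Context {R : realType} {V : normedModType R[i]}.
Implicit Types (g : R[i]^o -> V) (a u v : R[i]).

(* Left-endpoint Riemann sum of g over the segment from a to a + v, with 2 ^ n
   sample points; the recursive form makes bisection hold by definition. *)
Fixpoint edge_sum n g a v : V :=
  if n is m.+1 then edge_sum m g a (v / 2) + edge_sum m g (a + v / 2) (v / 2)
  else v *: g a.

Definition rect_sum n g a u v : V :=
  (edge_sum n g a u - edge_sum n g (a + v) u) +
  (edge_sum n g (a + u) v - edge_sum n g a v).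

Lemma rect_sumS n g a u v : rect_sum n.+1 g a u v =
  rect_sum n g a (u / 2) (v / 2) + rect_sum n g (a + u / 2) (u / 2) (v / 2) +
  rect_sum n g (a + v / 2) (u / 2) (v / 2) +
  rect_sum n g (a + u / 2 + v / 2) (u / 2) (v / 2).
Proof.
have addm (x y z : V) : x - z = (x - y) + (y - z) by rewrite addrA subrK.
rewrite /rect_sum /= !opprD.
have -> : a + u / 2 + v / 2 + v / 2 = a + v + u / 2 by field.
have -> : a + u / 2 + v / 2 + u / 2 = a + u + v / 2 by field.
have -> : a + v / 2 + u / 2 = a + u / 2 + v / 2 by field.
have -> : a + u / 2 + u / 2 = a + u by field.
have -> : a + v / 2 + v / 2 = a + v by field.
rewrite (addrACA (edge_sum n g a (u / 2))).
rewrite (addrACA (edge_sum n g (a + u) (v / 2))).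
rewrite [in LHS](addm _ (edge_sum n g (a + v / 2) (u / 2))
  (edge_sum n g (a + v) (u / 2))).
rewrite [in LHS](addm _ (edge_sum n g (a + u / 2 + v / 2) (u / 2))
  (edge_sum n g (a + v + u / 2) (u / 2))).
rewrite [in LHS](addm _ (edge_sum n g (a + u / 2) (v / 2)) (edge_sum n g a (v / 2))).
rewrite [in LHS](addm _ (edge_sum n g (a + u / 2 + v / 2) (v / 2))
  (edge_sum n g (a + v / 2) (v / 2))).
by rewrite [LHS](AC ((2*2)*(2*2)) ((1*6)*(3*5)*(2*8)*(4*7))).
Qed.

(** The recursive calls of [edge_sum] run over the two halves of a segment; this hands them any
    pointwise hypothesis on the whole. *)
Lemma in_halves v a (Q : R[i] -> Prop) :
  (forall t : R, 0 <= t <= 1 -> Q (a + t%:C * v)) ->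
  (forall t : R, 0 <= t <= 1 -> Q (a + t%:C * (v / 2))) /\
  (forall t : R, 0 <= t <= 1 -> Q (a + v / 2 + t%:C * (v / 2))).
Proof.
move=> Qv; split=> t t01.
  have -> : a + t%:C * (v / 2) = a + (t / 2)%:C * v.
    by rewrite rmorphM fmorphV rmorph_nat; field.
  by apply: Qv; lra.
have -> : a + v / 2 + t%:C * (v / 2) = a + ((1 + t) / 2)%:C * v.
  by rewrite rmorphM fmorphV rmorph_nat rmorphD rmorph1; field.
by apply: Qv; lra.
Qed.

Lemma cmod_half v : cmod (v / 2) = cmod v / 2.
Proof.
rewrite cmodM cmodV; congr (_ / _).
by rewrite -[2 in LHS](rmorph_nat (real_complex R)) cmod_real ger0_norm.
Qed.

Lemma edge_sum_le n g a v m :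
  (forall t : R, 0 <= t <= 1 -> rnorm (g (a + t%:C * v)) <= m) ->
  rnorm (edge_sum n g a v) <= cmod v * m.
Proof.
elim: n a v => [|n IHn] a v gm /=.
  rewrite rnormZ ler_wpM2l ?cmod_ge0//.
  by have := gm 0; rewrite mul0r addr0; apply; rewrite lexx ler01.
have [g1 g2] := in_halves (Q := fun z => rnorm (g z) <= m) gm.
apply: (le_trans (rnormD _ _)); apply: (le_trans (lerD (IHn _ _ g1) (IHn _ _ g2))).
by rewrite cmod_half; lra.
Qed.

Lemma eq_edge_sum n g1 g2 a v :
  (forall t : R, 0 <= t <= 1 -> g1 (a + t%:C * v) = g2 (a + t%:C * v)) ->
  edge_sum n g1 a v = edge_sum n g2 a v.
Proof.
elim: n a v => [|n IHn] a v gm /=.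
  by have := gm 0; rewrite mul0r addr0 => ->//; rewrite lexx ler01.
by have [e1 e2] := in_halves (Q := fun z => g1 z = g2 z) gm; rewrite !IHn.
Qed.

Lemma edge_sumB n g1 g2 a v : edge_sum n (fun z => g1 z - g2 z) a v =
  edge_sum n g1 a v - edge_sum n g2 a v.
Proof.
elim: n a v => [|n IHn] a v /=; first by rewrite scalerBr.
by rewrite !IHn opprD addrACA.
Qed.

Lemma rect_sumB n g1 g2 a u v : rect_sum n (fun z => g1 z - g2 z) a u v =
  rect_sum n g1 a u v - rect_sum n g2 a u v.
Proof.
rewrite /rect_sum !edge_sumB.
have acm (x y z t : V) : (x - y) - (z - t) = (x - z) - (y - t).
  by rewrite !opprB addrACA [RHS]addrACA [- y - z]addrC.
by rewrite acm [X in _ + X = _]acm [in RHS]opprD [RHS]addrACA.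
Qed.

(** Opposite edges are sampled alike, so at [n = 0] they contribute [- u v l] and [v u l], which
    cancel. The sums are thus exact at every [n], and no passage to the limit is needed. *)
Lemma rect_sum_affine n c l a u v : rect_sum n (fun z => c + z *: l) a u v = 0.
Proof.
elim: n a u v => [|n IHn] a u v; last by rewrite rect_sumS !IHn !addr0.
have d (x y : R[i]) : c + x *: l - (c + y *: l) = (x - y) *: l.
  by rewrite opprD addrACA subrr add0r scalerBl.
rewrite /rect_sum /= -!scalerBr !d !scalerA -scalerDl.
by rewrite [X in X *: _](_ : _ = 0) ?scale0r//; ring.
Qed.

Lemma rect_sum_le n g a u v m :
  (forall r t : R, 0 <= r <= 1 -> 0 <= t <= 1 ->
     rnorm (g (a + r%:C * u + t%:C * v)) <= m) ->
  rnorm (rect_sum n g a u v) <= 2 * (cmod u + cmod v) * m.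
Proof.
move=> gm.
have e1 : rnorm (edge_sum n g a u) <= cmod u * m.
  apply: edge_sum_le => t t01; have := gm t 0 t01.
  by rewrite mul0r addr0; apply; rewrite lexx ler01.
have e2 : rnorm (edge_sum n g (a + v) u) <= cmod u * m.
  apply: edge_sum_le => t t01; have := gm t 1 t01.
  by rewrite mul1r addrAC; apply; rewrite lexx ler01.
have e3 : rnorm (edge_sum n g a v) <= cmod v * m.
  apply: edge_sum_le => t t01; have := gm 0 t _ t01.
  by rewrite mul0r addr0; apply; rewrite lexx ler01.
have e4 : rnorm (edge_sum n g (a + u) v) <= cmod v * m.
  apply: edge_sum_le => t t01; have := gm 1 t _ t01.
  by rewrite mul1r; apply; rewrite lexx ler01.
apply: (le_trans (rnormD _ _)).
apply: (le_trans (lerD (rnormB _ _) (rnormB _ _))).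
by lra.
Qed.

End EdgeSums.

Lemma edge_sumZl {R : realType} {V : normedModType R[i]} n
    (k : R[i]^o -> R[i]^o) (c : V) (a v : R[i]) :
  edge_sum n (fun z => (k z : R[i]) *: c) a v = (edge_sum n k a v : R[i]) *: c.
Proof.
elim: n a v => [|n IHn] a v /=; first by rewrite scalerA.
by rewrite !IHn -scalerDl.
Qed.

(** * Induction by bisection of rectangles *)

Section Bisection.
Context {R : realType}.

Lemma exists_half_pow_lt (p d : R) : 0 < d -> exists n, p / 2 ^+ n < d.
Proof.
move=> d0; pose n := Num.bound `|p / d|; exists n.
rewrite ltr_pdivrMr ?exprn_gt0// mulrC -ltr_pdivrMr//.
apply: (le_lt_trans (ler_norm _)); apply: (lt_trans (archi_boundP _)) => //.
by rewrite -natrX ltr_nat ltn_expl.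
Qed.

Variables (P : R -> R -> R -> Prop) (rho x0 y0 p0 : R).

(** Picks a child on which [P] fails, the fourth by default; if [P] fails on the parent, the default
    is correct by the hypothesis on children. All rectangles keep the ratio [rho] of height to
    width. *)
Let next (t : R * R * R) : R * R * R :=
  let: (x, y, p) := t in let h := p / 2 in
  if `[< ~ P x y h >] then (x, y, h) else
  if `[< ~ P (x + h) y h >] then (x + h, y, h) else
  if `[< ~ P x (y + rho * h) h >] then (x, y + rho * h, h) else
  (x + h, y + rho * h, h).

Let T k := iter k next (x0, y0, p0).
Let X k := (T k).1.1.
Let Y k := (T k).1.2.
Let W k := (T k).2.

(** A compactness argument: if [P] failed, nested rectangles on which it fails would shrink to a
    point, and the local hypothesis there covers every small rectangle containing that point,
    wherever its corner is. *)
Lemma bisection_ind : 0 < p0 -> 0 <= rho ->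
  (forall x y p, P x y (p / 2) -> P (x + p / 2) y (p / 2) ->
     P x (y + rho * (p / 2)) (p / 2) ->
     P (x + p / 2) (y + rho * (p / 2)) (p / 2) -> P x y p) ->
  (forall a b, x0 <= a <= x0 + p0 -> y0 <= b <= y0 + rho * p0 ->
     exists2 d : R, 0 < d & forall x y p, 0 < p < d ->
       x0 <= x -> x + p <= x0 + p0 -> y0 <= y ->
       y + rho * p <= y0 + rho * p0 ->
       x <= a <= x + p -> y <= b <= y + rho * p -> P x y p) ->
  P x0 y0 p0.
Proof.
move=> p0_gt0 rho_ge0 Pchild Plocal; apply: contrapT => NP.
have WE k : W k = p0 / 2 ^+ k.
  elim: k => [|k]; first by rewrite expr0 divr1.
  rewrite /W /T /= -/(T k); case: (T k) => [[x y] p] /= ->.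
  have e : p0 / 2 ^+ k / 2 = p0 / 2 ^+ k.+1 by rewrite exprSr invfM mulrA.
  by do 3?case: ifP.
have W_gt0 k : 0 < W k by rewrite WE divr_gt0// exprn_gt0.
have NPT k : ~ P (X k) (Y k) (W k).
  elim: k => // k; rewrite /X /Y /W /T /= -/(T k).
  case: (T k) => [[x y] p] /= NPk.
  case: ifPn => [/asboolP//|/asboolPn/contrapT P1].
  case: ifPn => [/asboolP//|/asboolPn/contrapT P2].
  case: ifPn => [/asboolP//|/asboolPn/contrapT P3] P4.
  by apply: NPk; exact: Pchild.
have step k : [/\ X k <= X k.+1, X k.+1 + W k.+1 <= X k + W k,
    Y k <= Y k.+1 & Y k.+1 + rho * W k.+1 <= Y k + rho * W k].
  have := W_gt0 k; rewrite /X /Y /W /T /= -/(T k).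
  case: (T k) => [[x y] p] /= p_gt0.
  have rp : 0 <= rho * p by rewrite mulr_ge0// ltW.
  by do 3?case: ifP => _; split=> /=; lra.
have mono (k m : nat) : [/\ X k <= X (k + m)%N,
    X (k + m)%N + W (k + m)%N <= X k + W k, Y k <= Y (k + m)%N &
    Y (k + m)%N + rho * W (k + m)%N <= Y k + rho * W k].
  elim: m => [|m [h1 h2 h3 h4]]; first by rewrite addn0.
  have [s1 s2 s3 s4] := step (k + m)%N; rewrite addnS.
  by split; [exact: le_trans s1|exact: le_trans h2|exact: le_trans s3|
             exact: le_trans h4].
(* Every lower left corner is dominated by every upper right corner: compare both with step [k + m].
   Hence the suprema of the lower corners lie in all rectangles. *)
have cross k m : X k <= X m + W m /\ Y k <= Y m + rho * W m.
  have [h1 _ h3 _] := mono k m; have [_ h2 _ h4] := mono m k.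
  have wp := W_gt0 (k + m)%N.
  have rw : 0 <= rho * W (k + m)%N by rewrite mulr_ge0// ltW.
  by rewrite addnC in h2 h4; split; lra.
pose a := sup (range X); pose b := sup (range Y).
have aub k : X k <= a.
  apply: ub_le_sup; last by exists k.
  by exists (X 0%N + W 0%N) => _ [m _ <-]; have [] := cross m 0%N.
have bub k : Y k <= b.
  apply: ub_le_sup; last by exists k.
  by exists (Y 0%N + rho * W 0%N) => _ [m _ <-]; have [] := cross m 0%N.
have alb k : a <= X k + W k.
  apply: ge_sup; first by exists (X 0%N), 0%N.
  by move=> _ [m _ <-]; have [] := cross m k.
have blb k : b <= Y k + rho * W k.
  apply: ge_sup; first by exists (Y 0%N), 0%N.
  by move=> _ [m _ <-]; have [] := cross m k.
have [||d d0 dP] := Plocal a b.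
- by rewrite (aub 0%N) (alb 0%N).
- by rewrite (bub 0%N) (blb 0%N).
have [n nd] := exists_half_pow_lt p0 d0.
apply: (NPT n); have [h1 h2 h3 h4] := mono 0%N n.
apply: dP; rewrite ?aub ?alb ?bub ?blb//.
by rewrite W_gt0 WE.
Qed.

End Bisection.

(** * Goursat's theorem with exceptional vertical lines *)

Section Goursat.
Context {R : realType} {V : normedModType R[i]}.
Implicit Types (g : R[i]^o -> V) (es : seq R).

(* Caratheodory's form of complex differentiability. *)
Definition cdiff g (z : R[i]^o) := exists2 q : R[i]^o -> V,
  q w @[w --> z] --> q z & forall w, g w = g z + (w - z : R[i]) *: q w.

(** An exceptional abscissa contributes a jump of 2, split as 1 + 1 at the abscissa itself. So
    increments telescope under bisection, and a line along a side shared by two rectangles is still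
    charged to both. *)
Definition sgs es (x : R) : R := \sum_(e <- es) Num.sg (x - e).

Lemma sg_le (x y : R) : x <= y -> Num.sg x <= Num.sg y.
Proof. by case: sgrP => ?; case: sgrP => ?; lra. Qed.

Lemma sgs_le es x y : x <= y -> sgs es x <= sgs es y.
Proof. by move=> xy; apply: ler_sum => e _; rewrite sg_le// lerD2r. Qed.

Lemma sgs_jump es e x y : e \in es -> x < y -> x <= e <= y ->
  1 + sgs es x <= sgs es y.
Proof.
move=> ees xy xey; rewrite /sgs !(big_rem e ees)/= addrA lerD//.
  by case: (sgrP (x - e)) => ?; case: (sgrP (y - e)) => ?; lra.
by apply: ler_sum => e' _; rewrite sg_le// lerD2r ltW.
Qed.

Lemma rect_sum_sub_affine n g c l a u v m :
  (forall (r t : R) w, 0 <= r <= 1 -> 0 <= t <= 1 ->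
     w = a + r%:C * u + t%:C * v -> rnorm (g w - (c + w *: l)) <= m) ->
  rnorm (rect_sum n g a u v) <= 2 * (cmod u + cmod v) * m.
Proof.
move=> gm; rewrite -[rect_sum _ _ _ _ _]subr0 -(rect_sum_affine n c l a u v).
by rewrite -rect_sumB; apply: rect_sum_le => r t r01 t01; exact: (gm r t).
Qed.

(* nu(Q) = rho p (p + sgs (x + p) - sgs x) is additive under bisection and
   dominates both the area of Q and, when Q meets an exceptional line, its
   height; so mere continuity of g suffices on those lines. *)
Lemma goursat (D : set R[i]^o) es g (x0 y0 p0 rho : R) : 0 < p0 -> 0 < rho ->
  (forall x y, x0 <= x <= x0 + p0 -> y0 <= y <= y0 + rho * p0 ->
     D (x +i* y)) ->
  (forall z, D z -> g w @[w --> within D (nbhs z)] --> g z) ->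
  (forall z, D z -> complex.Re z \notin es -> cdiff g z) ->
  forall e : R, 0 < e -> exists N, forall n, (N <= n)%N ->
    rnorm (rect_sum n g (x0 +i* y0) p0%:C (0 +i* (rho * p0))) <= e.
Proof.
move=> p0_gt0 rho_gt0 rectD gcont gdiff e e_gt0.
pose nu x p := rho * p * (p + sgs es (x + p) - sgs es x).
have nu_ge x p : 0 < p -> rho * p * p <= nu x p.
  move=> p_gt0; rewrite ler_wpM2l//; first by rewrite mulr_ge0// ltW.
  by rewrite -addrA lerDl subr_ge0 sgs_le// lerDl ltW.
have nu0_gt0 : 0 < nu x0 p0.
  by apply: lt_le_trans (nu_ge _ _ p0_gt0); rewrite !mulr_gt0.
pose e1 := e / nu x0 p0; have e1_gt0 : 0 < e1 by rewrite divr_gt0.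
pose P x y p := exists N, forall n, (N <= n)%N ->
  rnorm (rect_sum n g (x +i* y) p%:C (0 +i* (rho * p))) <= e1 * nu x p.
suff [N NP] : P x0 y0 p0.
  by exists N => n /NP; rewrite /e1 divfK// gt_eqF.
have rho1 : 0 < 1 + rho by lra.
apply: (@bisection_ind _ P rho) => //; first exact: ltW.
  move=> x y p [N1 P1] [N2 P2] [N3 P3] [N4 P4].
  exists (N1 + N2 + N3 + N4).+1 => -[//|n]; rewrite ltnS => Nn; rewrite rect_sumS.
  have pE : p%:C / 2 = (p / 2)%:C by rewrite complex_half mul0r.
  have qE : (0 +i* (rho * p)) / 2 = 0 +i* (rho * (p / 2)).
    by rewrite complex_half mul0r mulrA.
  rewrite pE qE !addc_real !addc_imag.
  have {}P1 := P1 n; have {}P2 := P2 n; have {}P3 := P3 n; have {}P4 := P4 n.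
  have nuE : nu x p = nu x (p / 2) + nu (x + p / 2) (p / 2) +
                      nu x (p / 2) + nu (x + p / 2) (p / 2).
    by rewrite /nu (_ : x + p / 2 + p / 2 = x + p); [field|field].
  rewrite nuE !mulrDr.
  apply: (le_trans (rnormD _ _)); apply: lerD; last first.
    by apply: P4; rewrite (leq_trans _ Nn)// leq_addl.
  apply: (le_trans (rnormD _ _)); apply: lerD; last first.
    by apply: P3; rewrite (leq_trans _ Nn)// addnAC leq_addl.
  apply: (le_trans (rnormD _ _)); apply: lerD.
    by apply: P1; rewrite (leq_trans _ Nn)// -!addnA leq_addr.
  by apply: P2; rewrite (leq_trans _ Nn)// -!addnA addnCA leq_addr.
move=> a b ax bx; pose z : R[i]^o := a +i* b.
have Dz : D z by exact: rectD.
have close x y p : 0 < p -> x0 <= x -> x + p <= x0 + p0 -> y0 <= y ->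
    y + rho * p <= y0 + rho * p0 -> x <= a <= x + p -> y <= b <= y + rho * p ->
    forall (r t : R) (w : R[i]^o), 0 <= r <= 1 -> 0 <= t <= 1 ->
    w = x +i* y + r%:C * p%:C + t%:C * (0 +i* (rho * p)) ->
    D w /\ rnorm (w - z) <= (1 + rho) * p.
  move=> p_gt0 xx xp yy yp xa yb r t w r01 t01 wE0.
  have wE : w = (x + r * p) +i* (y + t * (rho * p)).
    by rewrite wE0; apply/eqP; rewrite eq_complex /=; apply/andP; split; apply/eqP; ring.
  have rp_ge0 : 0 <= rho * p by rewrite mulr_ge0// ltW.
  have rp : 0 <= r * p <= p by apply/andP; split; nra.
  have tp : 0 <= t * (rho * p) <= rho * p by apply/andP; split; nra.
  rewrite wE; split; first by apply: rectD; lra.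
  apply: (le_trans (cmod_leD (x + r * p - a) (y + t * (rho * p) - b))).
  rewrite mulrDl mul1r; apply: lerD; rewrite ler_norml; lra.
have cmodp (p : R) : 0 < p -> cmod p%:C = p.
  by move=> p_gt0; rewrite cmod_real gtr0_norm.
have cmodq (p : R) : 0 < p -> cmod (0 +i* (rho * p)) = rho * p.
  by move=> p_gt0; rewrite cmod_imag gtr0_norm// mulr_gt0.
have [aes|aes] := boolP (a \in es).
  (* Makes the bound [2 * (p + rho * p) * e2] equal to [e1] times the height, which [sgs_jump] puts
     below [e1 * nu x p]. *)
  pose e2 := e1 * rho / (2 * (1 + rho)).
  have e2_gt0 : 0 < e2 by rewrite divr_gt0// mulr_gt0.
  have /cvg_rnormP/(_ _ e2_gt0)/nbhs_rnormP[d d_gt0 dg] := gcont _ Dz.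
  exists (d / (1 + rho)); first by rewrite divr_gt0.
  move=> x y p /andP[p_gt0 pd] xx xp yy yp xa yb.
  exists 0%N => n _.
  have := @rect_sum_sub_affine n g (g z) 0 (x +i* y) p%:C (0 +i* (rho * p)) e2.
  rewrite cmodp// cmodq// => bound; apply: le_trans (bound _) _ => {bound}.
    move=> r t w r01 t01 wE; rewrite scaler0 addr0.
    have [Dw wz] := close _ _ _ p_gt0 xx xp yy yp xa yb _ _ _ r01 t01 wE.
    apply: dg => //; apply: (le_lt_trans wz).
    by rewrite mulrC -ltr_pdivlMr.
  have -> : 2 * (p + rho * p) * e2 = e1 * (rho * p * 1).
    by rewrite /e2; field; rewrite gt_eqF.
  rewrite ler_wpM2l ?(ltW e1_gt0)// ler_wpM2l//.
    by rewrite mulr_ge0// ltW.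
  have := sgs_jump aes _ xa; rewrite ltrDl => /(_ p_gt0); lra.
have [q qz gE] := gdiff _ Dz aes.
(* The deviation from the tangent is now at most [(1 + rho) * p * e2], so the bound is [e1] times
   the area [rho * p * p]. *)
pose e2 := e1 * rho / (2 * (1 + rho) ^+ 2).
have e2_gt0 : 0 < e2 by rewrite divr_gt0// mulr_gt0// exprn_gt0.
have /cvg_rnormP/(_ _ e2_gt0)/nbhs_rnormP[d d_gt0 dg] := qz.
exists (d / (1 + rho)); first by rewrite divr_gt0.
move=> x y p /andP[p_gt0 pd] xx xp yy yp xa yb.
exists 0%N => n _.
have := @rect_sum_sub_affine n g (g z - z *: q z) (q z) (x +i* y) p%:C
  (0 +i* (rho * p)) ((1 + rho) * p * e2).
rewrite cmodp// cmodq// => bound; apply: le_trans (bound _) _ => {bound}.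
  move=> r t w r01 t01 wE.
  have [Dw wz] := close _ _ _ p_gt0 xx xp yy yp xa yb _ _ _ r01 t01 wE.
  have -> : g w - (g z - z *: q z + w *: q z) = (w - z : R[i]) *: (q w - q z).
    rewrite gE scalerBr [(w - z) *: q z]scalerBl -[g z - _ + _]addrA opprD addrACA.
    by rewrite subrr add0r [- _ + w *: _]addrC.
  rewrite rnormZ; apply: ler_pM; rewrite ?rnorm_ge0//.
  apply: dg => //; apply: (le_lt_trans wz).
  by rewrite mulrC -ltr_pdivlMr.
have -> : 2 * (p + rho * p) * ((1 + rho) * p * e2) = e1 * (rho * p * p).
  by rewrite /e2; field; rewrite gt_eqF.
by rewrite ler_wpM2l ?(ltW e1_gt0)// nu_ge.
Qed.

End Goursat.

(** * Complex differentiability in Caratheodory's form *)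

Lemma near_cvg_to {R : realType} {V : normedModType R[i]} {T : Type}
    (F : set_system T) {FF : Filter F} (f g : T -> V) (l : V) :
  (\forall x \near F, f x = g x) -> f x @[x --> F] --> l -> g x @[x --> F] --> l.
Proof.
move=> fg /cvg_rnormP fl; apply/cvg_rnormP => e /fl.
by apply: filterS2 fg => x ->.
Qed.

(** For [cdiff_inv]: the Caratheodory quotient of [1 / k], with [r] that of [k]. *)
Lemma cvg_inv_quotient {K : numFieldType} {T : Type} (F : set_system T)
    {FF : Filter F} (r k : T -> K) (c d : K) : d != 0 ->
  r x @[x --> F] --> c -> k x @[x --> F] --> d ->
  - (r x * ((k x)^-1 * d^-1)) @[x --> F] --> - (c * (d^-1 * d^-1)).
Proof.
move=> d0 rc kd; apply: cvgN; apply: cvgM => //.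
by apply: cvgM; [exact: cvgV|exact: cvg_cst].
Qed.

Section ComplexDifferentiability.
Context {R : realType}.
Local Notation C := R[i]^o.

Section Vector.
Context {V : normedModType R[i]}.
Implicit Types (g : C -> V) (z : C).

(** [cdiff] demands its identity at every [w]; away from [z] the difference quotient always
    satisfies it, so a local identity suffices. *)
Lemma cdiff_near g z (q : C -> V) : q w @[w --> z] --> q z ->
  (\forall w \near z, g w = g z + (w - z : R[i]) *: q w) -> cdiff g z.
Proof.
move=> qz gE.
exists (fun w => if w == z then q z else (w - z : R[i])^-1 *: (g w - g z)).
  rewrite eqxx; apply: near_cvg_to qz.
  apply: filterS gE => w ->; case: eqP => [->//|/eqP wz].
  by rewrite addrAC subrr add0r scalerK// subr_eq0.
move=> w; case: eqP => [->|/eqP wz]; first by rewrite subrr scale0r addr0.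
by rewrite scalerKV ?subr_eq0// addrC subrK.
Qed.

Lemma eq_cdiff_near g1 g2 z : (\forall w \near z, g1 w = g2 w) ->
  cdiff g1 z -> cdiff g2 z.
Proof.
move=> g12 [q qz gE]; apply: (cdiff_near qz).
have g12z := nbhs_singleton g12.
by apply: filterS g12 => w <-; rewrite -g12z.
Qed.

Lemma cdiff_continuous g z : cdiff g z -> g w @[w --> z] --> g z.
Proof.
move=> [q qz gE].
have : g z + (w - z : R[i]) *: q w @[w --> z] --> g z + (z - z : R[i]) *: q z.
  apply: (cvgD (F := nbhs z)); first exact: cvg_cst.
  apply: (cvgZ (F := nbhs z)) => //.
  by apply: (cvgB (F := nbhs z)); [exact: cvg_id|exact: cvg_cst].
rewrite subrr scale0r addr0; apply: (near_cvg_to (F := nbhs z)).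
by near=> w; rewrite -gE.
Unshelve. all: by end_near. Qed.

Lemma derivable_cdiff g z : derivable g z 1 <-> cdiff g z.
Proof.
split=> [/cvg_ex[l gl]|[q qz gE]].
  pose q w := if w == z then l else (w - z : R[i])^-1 *: (g w - g z).
  apply: (@cdiff_near g z q).
    rewrite {2}/q eqxx; apply/(cvg_rnormP (F := nbhs z)) => e e0.
    have /cvg_rnormP/(_ e e0)/nbhs_rnormP[d d0 dl] := gl.
    apply/nbhs_rnormP; exists d => // w wz; rewrite /q.
    case: eqP => [_|/eqP nwz]; first by rewrite subrr rnorm0 ltW.
    have := dl (w - z); rewrite /= subr0 subr_eq0 => /(_ wz nwz).
    by rewrite /GRing.scale /= mulr1 subrK.
  near=> w; rewrite /q; case: eqP => [->|/eqP wz].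
    by rewrite subrr scale0r addr0.
  by rewrite scalerKV ?subr_eq0// addrC subrK.
apply/cvg_ex; exists (q z); apply/cvg_rnormP => e e0.
have /cvg_rnormP/(_ e e0)/nbhs_rnormP[d d0 dq] := qz.
apply/nbhs_rnormP; exists d => // h; rewrite /= subr0 => hd h0.
have -> : (h : R[i]) *: (1 : C) = h by rewrite /GRing.scale /= mulr1.
rewrite gE addrAC subrr add0r addrK scalerK//.
by apply: dq; rewrite addrK.
Unshelve. all: by end_near. Qed.

Lemma cdiff_cst (c : V) z : cdiff (fun=> c) z.
Proof.
exists (fun=> 0); last by move=> w; rewrite scaler0 addr0.
exact: (@cvg_cst V 0 _ (nbhs z)).
Qed.

Lemma cdiff_subr g z c : cdiff g z -> cdiff (fun w => g w - c) z.
Proof. by move=> [q qz gE]; exists q => // w; rewrite gE addrAC. Qed.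

Lemma cdiffZ (k : C -> C) g z : cdiff k z -> cdiff g z ->
  cdiff (fun w => (k w : R[i]) *: g w) z.
Proof.
move=> kd gd; have [q qz gE] := gd; have [r rz kE] := kd.
exists (fun w => (r w : R[i]) *: g w + (k z : R[i]) *: q w).
  apply: (cvgD (F := nbhs z)).
    by apply: (cvgZ (F := nbhs z)) => //; exact: cdiff_continuous.
  exact: (@cvgZl_tmp _ _ _ (nbhs z) _ (k z) q (q z) qz).
move=> w; rewrite {1}kE scalerDl scalerDr !scalerA.
have -> : ((w - z : R[i]) *: (r w : C) : C) = (w - z : R[i]) * r w by [].
rewrite [in k z *: g w]gE scalerDr !scalerA [_ * k z]mulrC -!addrA.
by congr (_ + _); rewrite addrC.
Qed.

End Vector.

Lemma cdiff_affine (c d : R[i]) (z : C) : cdiff ((fun w => c + d * w) : C -> C) z.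
Proof.
exists (fun=> d : C); first exact: (@cvg_cst C d _ (nbhs z)).
by move=> w; rewrite /GRing.scale /=; ring.
Qed.

Lemma cdiff_inv (k : C -> C) (z : C) : k z != 0 -> cdiff k z ->
  cdiff ((fun w => (k w : R[i])^-1) : C -> C) z.
Proof.
move=> kz kd; have [r rz kE] := kd; have kc := cdiff_continuous kd.
apply: (@cdiff_near _ _ _ (fun w => - (r w * ((k w : R[i])^-1 * (k z)^-1)))).
  exact: (@cvg_inv_quotient R[i] _ (nbhs z) _ _ _ _ _ kz rz kc).
have kN : \forall w \near z, k w != 0 by exact: (@cvgr_neq0 _ C _ (nbhs z)) kc kz.
near=> w; have kw : k w != 0 by near: w.
have wz : (w - z) * r w = k w - k z.
  by rewrite [k w]kE addrAC subrr add0r.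
rewrite /GRing.scale /= mulrN mulrA wz; field.
by rewrite kw kz.
Unshelve. all: by end_near. Qed.

End ComplexDifferentiability.

(** * Bounded holomorphic functions on the strip *)

Section StripHolomorphic.
Context {R : realType}.
Local Notation C := R[i]^o.

(** What remains of [calderon] without the trace in [X] and without decay, so that scalar factors
    belong to the class and products can be formed before any decay is known. *)
Definition strip_holomorphic {V : normedModType R[i]} (g : C -> V) : Prop :=
  [/\ exists M : R, forall z, strip z -> rnorm (g z) <= M,
      forall z, strip z -> g w @[w --> within strip (nbhs z)] --> g z &
      forall z : C, 0 < complex.Re z < 1 -> cdiff g z].

Lemma strip_holomorphicZ {V : normedModType R[i]} (k : C -> C) (g : C -> V) :
  strip_holomorphic k -> strip_holomorphic g ->
  strip_holomorphic (fun w => (k w : R[i]) *: g w).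
Proof.
move=> [[M kM] kc kd] [[N gN] gc gd]; split.
- exists (M * N) => z Sz; rewrite rnormZ.
  by apply: ler_pM; rewrite ?rnorm_ge0 ?kM ?gN.
- by move=> z Sz; apply: (cvgZ (F := within strip (nbhs z))); [exact: kc|exact: gc].
- by move=> z Sz; apply: cdiffZ; [exact: kd|exact: gd].
Qed.

Lemma strip_holomorphicX (k : C -> C) n : strip_holomorphic k ->
  strip_holomorphic ((fun w => (k w : R[i]) ^+ n) : C -> C).
Proof.
move=> kh; elim: n => [|n IHn].
  split.
  - by exists 1 => z _; rewrite expr0 [rnorm _](cmod_real 1) normr1.
  - by move=> z _; exact: (@cvg_cst C 1 _ (within strip (nbhs z))).
  - move=> z _; exact: (@cdiff_cst _ C 1).
have -> : (fun w => (k w : R[i]) ^+ n.+1) =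
    fun w => (k w : R[i]) *: (((k w : R[i]) ^+ n) : C).
  by apply/funext => w; rewrite exprS.
exact: strip_holomorphicZ.
Qed.

(** All damping factors below have this form. The bound on the real part of the denominator keeps
    the pole outside the closed strip. *)
Lemma strip_holomorphic_inv (c d e : R) :
  (forall z : C, strip z -> 1 <= c + d * complex.Re z) ->
  strip_holomorphic ((fun w => e%:C * (c%:C + d%:C * w)^-1) : C -> C).
Proof.
move=> cd.
have l_ge1 (z : C) : strip z -> 1 <= cmod (c%:C + d%:C * z : R[i]).
  move=> /cd cdz; apply: (le_trans cdz); apply: le_trans (cmod_geRe _).
  by case: z {cdz} => x y /=; rewrite mul0r subr0 ler_norm.
have l_neq0 (z : C) : strip z -> (c%:C + d%:C * z : R[i]) != 0.
  move=> /l_ge1; apply: contraTneq => ->.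
  by rewrite /cmod rnorm0 -ltNge ltr01.
have ld z : strip z -> cdiff ((fun w => e%:C * (c%:C + d%:C * w)^-1) : C -> C) z.
  move=> Sz; apply: (@cdiffZ _ C (fun=> e%:C)).
    exact: cdiff_cst.
  by apply: cdiff_inv; [exact: l_neq0|exact: cdiff_affine].
split.
- exists `|e| => z Sz; rewrite -/(cmod _) cmodM cmodV cmod_real.
  rewrite ler_piMr// invf_le1 ?l_ge1//.
  exact: lt_le_trans (l_ge1 _ Sz).
- move=> z Sz; apply: cvg_within_filter; exact: cdiff_continuous (ld _ Sz).
- by move=> z /andP[z0 z1]; apply: ld; rewrite /strip /= !ltW.
Qed.

End StripHolomorphic.

(** * Riemann sums over vertical edges *)

Section VerticalEdges.
Context {R : realType}.
Implicit Types (x y h c : R).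

(* A rational stand-in for atan: its increments are comparable with those of
   the primitive of 1 / (1 + y ^ 2), so the bounds below telescope. *)
Definition gamma y : R := y / (1 + `|y|).

(** With [A = 1 + |y|] and [B = 1 + |y + h|] the increment is [N / (A * B)], where
    [h <= N <= 3 * h]. As [h <= 1], [A] and [B] agree up to a factor 2, and [A ^ 2] lies between
    [1 + y ^ 2] and its double; hence 4 and 6. *)
Lemma gamma_incr y h : 0 < h <= 1 ->
  h / (1 + y ^+ 2) <= 4 * (gamma (y + h) - gamma y) /\
  gamma (y + h) - gamma y <= 6 * (h / (1 + y ^+ 2)).
Proof.
move=> /andP[h0 h1].
pose A := 1 + `|y|; pose B := 1 + `|y + h|.
have A1 : 1 <= A by rewrite lerDl.
have B1 : 1 <= B by rewrite lerDl.
have A0 : 0 < A by lra.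
have B0 : 0 < B by lra.
have [N1 N2] : h <= (y + h) * A - y * B /\ (y + h) * A - y * B <= 3 * h.
  by rewrite /A /B; case: (ger0P y) => ?; case: (ger0P (y + h)) => ?; split; nra.
have [AB BA] : A <= 2 * B /\ B <= 2 * A.
  by rewrite /A /B; case: (ger0P y) => ?; case: (ger0P (y + h)) => ?; split; lra.
have y2 : `|y| ^+ 2 = y ^+ 2 by rewrite real_normK// num_real.
have [S1 S2] : 1 + y ^+ 2 <= A ^+ 2 /\ A ^+ 2 <= 2 * (1 + y ^+ 2).
  rewrite -y2 /A; move: (normr_ge0 y) (sqr_ge0 (1 - `|y|)).
  by move: (`|y|) => a a0 sa; split; nra.
have S0 : 0 < 1 + y ^+ 2 by have := sqr_ge0 y; lra.
have AB0 : 0 < A * B by rewrite mulr_gt0.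
have -> : gamma (y + h) - gamma y = ((y + h) * A - y * B) / (A * B).
  by rewrite /gamma -/A -/B; field; rewrite !gt_eqF.
move: N1 N2; set N := _ - _ => N1 N2; split.
  rewrite mulrA ler_pdivrMr// mulrAC ler_pdivlMr//.
  apply: (@le_trans _ _ (h * (4 * (1 + y ^+ 2)))); last by nra.
  by rewrite ler_pM2l//; nra.
rewrite mulrA ler_pdivrMr// mulrAC ler_pdivlMr//.
apply: (@le_trans _ _ (3 * h * A ^+ 2)).
  by apply: ler_pM => //; [lra|exact: ltW].
have -> : 6 * h * (A * B) = 3 * h * (A * (2 * B)) by ring.
by rewrite ler_pM2l; [rewrite expr2 ler_pM2l|lra].
Qed.

Lemma gamma_lt1 y : `|gamma y| <= 1.
Proof.
have p : 0 < 1 + `|y| by rewrite ltr_pwDl.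
by rewrite /gamma normrM normfV (gtr0_norm p) ler_pdivrMr// mul1r lerDr.
Qed.

Lemma gamma_sym_ge1 y : 1 <= y -> 1 <= gamma y - gamma (- y).
Proof.
move=> y1; rewrite /gamma normrN ger0_norm; last by lra.
rewrite mulNr opprK -mulr2n -mulr_natr mulrAC ler_pdivlMr; lra.
Qed.

(** The condition [h <= 2 ^ n] makes the steps after [n] bisections at most 1, as [gamma_incr]
    requires; the increments of [gamma] then telescope, so the bound is uniform in the length of the
    edge. *)
Lemma vertical_edge_sum_le {V : normedModType R[i]} n (g : R[i]^o -> V)
    x y h c : (forall t, rnorm (g (x +i* t)) <= c / (1 + t ^+ 2)) ->
  0 < h <= 2 ^+ n ->
  rnorm (edge_sum n g (x +i* y) (0 +i* h)) <=
    4 * c * (gamma (y + h) - gamma y).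
Proof.
move=> gc; have c0 : 0 <= c.
  by have := gc 0; rewrite expr0n addr0 divr1; apply/le_trans/rnorm_ge0.
elim: n y h => [|n IHn] y h /andP[h0 hn] /=.
  rewrite rnormZ -/(cmod _) cmod_imag gtr0_norm//.
  have [|G _] := @gamma_incr y h; first by rewrite h0 -(expr0 2).
  rewrite [4 * c]mulrC -mulrA; apply: le_trans (ler_wpM2l c0 G).
  by rewrite mulrCA; apply: ler_wpM2l; [exact: ltW|exact: gc].
rewrite imag_half addc_imag; apply: (le_trans (rnormD _ _)).
have h2 : 0 < h / 2 <= 2 ^+ n.
  by rewrite exprS in hn; apply/andP; split; lra.
apply: (le_trans (lerD (IHn y _ h2) (IHn (y + h / 2) _ h2))).
have -> : y + h / 2 + h / 2 = y + h by field.
by rewrite le_eqVlt; apply/orP; left; apply/eqP; ring.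
Qed.

Lemma vertical_edge_sum_Im_ge n (k : R[i]^o -> R[i]^o) x y h c : 0 <= c ->
  (forall t, c / (1 + t ^+ 2) <= complex.Re (k (x +i* t))) ->
  0 < h <= 2 ^+ n ->
  c / 6 * (gamma (y + h) - gamma y) <=
    complex.Im (edge_sum n k (x +i* y) (0 +i* h) : R[i]).
Proof.
move=> c0 kc; elim: n y h => [|n IHn] y h /andP[h0 hn] /=.
  have [|_ G] := @gamma_incr y h; first by rewrite h0 -(expr0 2).
  have c6 : 0 <= c / 6 by rewrite divr_ge0.
  apply: (le_trans (ler_wpM2l c6 G)).
  have -> : complex.Im (((0 +i* h : R[i]) *: k (x +i* y)) : R[i]) =
      h * complex.Re (k (x +i* y)).
    by case: (k _) => a b /=; rewrite mul0r add0r.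
  apply: le_trans (ler_wpM2l (ltW h0) (kc y)).
  by rewrite le_eqVlt; apply/orP; left; apply/eqP; field;
     rewrite gt_eqF// ltr_pwDl// sqr_ge0.
rewrite imag_half addc_imag.
have h2 : 0 < h / 2 <= 2 ^+ n.
  by rewrite exprS in hn; apply/andP; split; lra.
rewrite ImD; apply: le_trans (lerD (IHn y _ h2) (IHn (y + h / 2) _ h2)).
have -> : y + h / 2 + h / 2 = y + h by field.
by rewrite le_eqVlt; apply/orP; left; apply/eqP; ring.
Qed.

(** [e] serves as a sign: 1 or -1 according to the orientation of the edge in the contour. *)
Lemma edge_sum_Im_ge0 n (k : R[i]^o -> R[i]^o) (a v : R[i]) e :
  (forall t : R, 0 <= t <= 1 -> 0 <= e * complex.Im (v * k (a + t%:C * v))) ->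
  0 <= e * complex.Im (edge_sum n k a v : R[i]).
Proof.
elim: n a v => [|n IHn] a v kv.
  by have := kv 0; rewrite mul0r addr0; apply; rewrite lexx ler01.
have half (u : R[i]) : complex.Im (v / 2 * u) = complex.Im (v * u) / 2.
  rewrite -mulrA mulrCA mulrC.
  by case: (v * u) => p q; rewrite complex_half.
have [k1 k2] := in_halves (Q := fun z => 0 <= e * complex.Im (v * k z)) kv.
rewrite [edge_sum _ _ _ _]/= ImD mulrDr addr_ge0// IHn// => t t01.
  by rewrite half mulrA divr_ge0// k1.
by rewrite half mulrA divr_ge0// k2.
Qed.

(** Lets a difference quotient be replaced by its formula with the Cauchy kernel, which is available
    only off the pole inside the rectangle. *)
Lemma eq_rect_sum {V : normedModType R[i]} n (g1 g2 : R[i]^o -> V) x y p q :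
  0 <= p -> 0 <= q ->
  (forall t, y <= t <= y + q -> g1 (x +i* t) = g2 (x +i* t) /\
                                g1 ((x + p) +i* t) = g2 ((x + p) +i* t)) ->
  (forall t, x <= t <= x + p -> g1 (t +i* y) = g2 (t +i* y) /\
                                g1 (t +i* (y + q)) = g2 (t +i* (y + q))) ->
  rect_sum n g1 (x +i* y) p%:C (0 +i* q) = rect_sum n g2 (x +i* y) p%:C (0 +i* q).
Proof.
move=> p0 q0 gv gh.
have hE (t b : R) : (x +i* b) + t%:C * p%:C = (x + t * p) +i* b :> R[i].
  by rewrite -rmorphM addc_real.
have vE (t a : R) : (a +i* y) + t%:C * (0 +i* q) = a +i* (y + t * q) :> R[i].
  rewrite -addc_imag; congr (_ + _).
  by apply/eqP; rewrite eq_complex /=; apply/andP; split; apply/eqP; ring.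
rewrite /rect_sum addc_imag addc_real.
have tp (t : R) : 0 <= t <= 1 -> x <= x + t * p <= x + p.
  by move=> /andP[t0 t1]; apply/andP; split; nra.
have tq (t : R) : 0 <= t <= 1 -> y <= y + t * q <= y + q.
  by move=> /andP[t0 t1]; apply/andP; split; nra.
congr (_ - _ + (_ - _)); apply: eq_edge_sum => t t01; rewrite ?hE ?vE.
- by have [] := gh _ (tp _ t01).
- by have [] := gh _ (tp _ t01).
- by have [] := gv _ (tq _ t01).
- by have [] := gv _ (tq _ t01).
Qed.

End VerticalEdges.

(** * Cauchy kernel and a crude three lines estimate *)

Section ThreeLines.
Context {R : realType} {V : normedModType R[i]}.
Local Notation C := R[i]^o.

Lemma cmod_mono (x y x' y' : R) : x ^+ 2 <= x' ^+ 2 -> y ^+ 2 <= y' ^+ 2 ->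
  cmod (x +i* y) <= cmod (x' +i* y').
Proof.
move=> xx yy; rewrite -(@ler_pXn2r _ 2)// ?nnegrE ?cmod_ge0//.
by rewrite !cmodE lerD.
Qed.

Lemma cmod_inv_affine (c d e x y : R) :
  cmod (e%:C * (c%:C + d%:C * (x +i* y))^-1) =
  `|e| / cmod ((c + d * x) +i* (d * y)).
Proof.
rewrite cmodM cmodV cmod_real; congr (_ / cmod _).
by apply/eqP; rewrite eq_complex /=; apply/andP; split; apply/eqP; ring.
Qed.

Lemma complex_inv (x y : R) : (x +i* y)^-1 =
  (x / (x ^+ 2 + y ^+ 2)) +i* (- (y / (x ^+ 2 + y ^+ 2))).
Proof. by []. Qed.

Section CauchyKernel.
Variable s : R.
Hypothesis s01 : 0 < s < 1.

(** Written with [1 * w] so that [cdiff_affine] applies to the denominator. *)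
Definition cauchy_kernel : C -> C := fun w => (- s%:C + 1 * w)^-1.
Local Notation kap := cauchy_kernel.

Let s0 : 0 < s. Proof. by case/andP: s01. Qed.
Let s1 : 0 < 1 - s. Proof. by rewrite subr_gt0; case/andP: s01. Qed.

Lemma kernelE x y : kap (x +i* y) = ((x - s) +i* y)^-1.
Proof.
rewrite /kap; congr (_^-1).
by apply/eqP; rewrite eq_complex /=; apply/andP; split; apply/eqP; ring.
Qed.

Lemma cdiff_kernel (z : C) : z != s%:C -> cdiff kap z.
Proof.
move=> zs; apply: cdiff_inv; last exact: cdiff_affine.
by rewrite mul1r addrC subr_eq0.
Qed.

(** Stands in for the value [2 pi i] of the contour integral. All four edges contribute nonnegative
    imaginary parts, so the right one alone suffices: there the real part of the kernel is at least
    [(1 - s) / (1 + t ^ 2)]. *)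
Lemma kernel_rect_ge (L : R) n : 1 <= L -> 2 * L <= 2 ^+ n ->
  (1 - s) / 6 <=
  cmod (rect_sum n kap (0 +i* - L) 1%:C (0 +i* (2 * L))).
Proof.
move=> L1 Ln; apply: le_trans (le_trans (ler_norm _) (cmod_geIm _)).
have ImN (u : R[i]) : complex.Im (- u) = - complex.Im u by case: u.
rewrite /rect_sum !ImD !ImN addc_imag addc_real add0r.
have -> : - L + 2 * L = L by ring.
have hE (t b : R) : (0 +i* b) + t%:C * 1%:C = t +i* b :> R[i].
  by rewrite -rmorphM addc_real add0r mulr1.
have L0 : 0 < L by lra.
have bot : 0 <= complex.Im (edge_sum n kap (0 +i* - L) 1%:C : R[i]).
  rewrite -[complex.Im _]mul1r; apply: edge_sum_Im_ge0 => t t01.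
  rewrite hE kernelE mul1r complex_inv /= mul0r addr0 mul1r mulNr opprK.
  by rewrite divr_ge0 ?addr_ge0 ?sqr_ge0// ltW.
have top : 0 <= -1 * complex.Im (edge_sum n kap (0 +i* L) 1%:C : R[i]).
  apply: edge_sum_Im_ge0 => t t01.
  rewrite hE kernelE complex_inv /= mul0r addr0 mul1r mulrNN mul1r.
  by rewrite divr_ge0 ?addr_ge0 ?sqr_ge0// ltW.
have left : 0 <= -1 * complex.Im (edge_sum n kap (0 +i* - L) (0 +i* (2 * L)) : R[i]).
  apply: edge_sum_Im_ge0 => t t01.
  have -> : (0 +i* - L) + t%:C * (0 +i* (2 * L)) = 0 +i* (- L + t * (2 * L)) :> R[i].
    rewrite -addc_imag; congr (_ + _).
    by apply/eqP; rewrite eq_complex /=; apply/andP; split; apply/eqP; ring.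
  rewrite kernelE complex_inv /= mul0r add0r sub0r mulNr mul1r !mulNr mulrN opprK.
  by rewrite !mulr_ge0 ?invr_ge0 ?addr_ge0 ?sqr_ge0 ?(ltW s0) ?(ltW L0).
have right : (1 - s) / 6 <=
    complex.Im (edge_sum n kap (1 +i* - L) (0 +i* (2 * L)) : R[i]).
  have := @vertical_edge_sum_Im_ge _ n kap 1 (- L) (2 * L) (1 - s).
  have -> : - L + 2 * L = L by ring.
  move=> rgt; apply: le_trans (rgt _ _ _).
  - by rewrite ler_peMr ?gamma_sym_ge1// divr_ge0// ltW.
  - exact: ltW.
  - move=> t; rewrite kernelE complex_inv /=.
    rewrite ler_pM2l// lef_pV2 ?posrE.
    + by rewrite lerD2r; move: s0 s1 => s_gt0 s_lt1; nra.
    + by rewrite ltr_pwDl ?sqr_ge0 ?exprn_gt0.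
    + by rewrite ltr_pwDl ?sqr_ge0 ?exprn_gt0.
  - by rewrite Ln andbT; lra.
move: bot top left right.
set e1 := complex.Im _; set e2 := complex.Im _; set e3 := complex.Im _.
by set e4 := complex.Im _; lra.
Qed.

End CauchyKernel.

End ThreeLines.

Section ThreeLinesEstimate.
Context {R : realType} {V : normedModType R[i]}.
Local Notation C := R[i]^o.

Lemma difference_quotient_kernel (s : R) (g q : C -> V) :
  (forall w, g w = g s%:C + (w - s%:C : R[i]) *: q w) ->
  forall w, w != s%:C ->
  q w = (cauchy_kernel s w : R[i]) *: (g w - g s%:C).
Proof.
move=> qE w ws; rewrite qE addrAC subrr add0r scalerA /cauchy_kernel.
by rewrite mul1r addrC mulVf ?scale1r// subr_eq0.
Qed.

Lemma near_neq (z z0 : C) : z != z0 -> \forall w \near z, w != z0.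
Proof.
move=> zz0; apply/nbhs_rnormP; exists (rnorm (z - z0)).
  rewrite lt_neqAle rnorm_ge0 andbT eq_sym; apply: contra zz0 => /eqP.
  by move=> /rnorm_eq0/eqP; rewrite subr_eq0.
by move=> w; apply: contraTneq => ->; rewrite rdistC ltxx.
Qed.

(** The exceptional lines are Re = 0, s, 1: at [s] the quotient is known to be continuous but not
    differentiable, and on the boundary only continuity within the strip is available. *)
Lemma goursat_difference_quotient (s : R) (g q : C -> V) : 0 < s < 1 ->
  strip_holomorphic g -> q w @[w --> (s%:C : C)] --> q s%:C ->
  (forall w, g w = g s%:C + (w - s%:C : R[i]) *: q w) ->
  forall (L e : R), 0 < L -> 0 < e -> exists N, forall n, (N <= n)%N ->
    rnorm (rect_sum n q (0 +i* - L) 1%:C (0 +i* (2 * L))) <= e.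
Proof.
move=> s01 [_ gc gd] qc qE L e L0 e0.
have qK := difference_quotient_kernel qE.
have := @goursat R V strip [:: 0; s; 1] q 0 (- L) 1 (2 * L).
rewrite mulr1; apply => //.
- by rewrite mulr_gt0.
- by move=> x y x01 _; rewrite /strip /=; move: x01; rewrite add0r.
- move=> z Sz; have [->|zs] := eqVneq z s%:C.
    exact: (cvg_within_filter (F := nbhs _)).
  apply: (@near_cvg_to _ _ _ (within strip (nbhs z)) _
     (fun w => (cauchy_kernel s w : R[i]) *: (g w - g s%:C))).
    have := near_neq zs; rewrite /prop_near1 /within /=.
    by apply: filterS => w ws _; rewrite qK.
  rewrite qK//; apply: (cvgZ (F := within strip (nbhs z))).
    apply: (cvg_within_filter (F := nbhs z)).
    exact: cdiff_continuous (cdiff_kernel zs).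
  apply: (cvgB (F := within strip (nbhs z))); first exact: gc.
  exact: (@cvg_cst V _ _ (within strip (nbhs z))).
- move=> z Sz; rewrite !inE !negb_or => /and3P[z0 zs z1].
  have {}zs : z != s%:C by apply: contra zs => /eqP ->.
  apply: (@eq_cdiff_near _ _ (fun w => (cauchy_kernel s w : R[i]) *: (g w - g s%:C))).
    by have := near_neq zs; apply: filterS => w ws; rewrite qK.
  apply: cdiffZ; first exact: cdiff_kernel.
  apply: cdiff_subr; apply: gd.
  by move: Sz; rewrite /strip /= !lt_neqAle eq_sym z0 z1.
Qed.

(** Cauchy's formula for [G / (1 + z)]. The extra factor makes the integrand decay like
    [1 / (1 + t ^ 2)] on the vertical edges, so their share stays bounded as [L] grows, while the
    horizontal edges become negligible. *)
Lemma three_lines_weak (s : R) : 0 < s < 1 -> exists2 K : R, 0 < K &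
  forall (G : C -> V) (a b : R), strip_holomorphic G ->
    (forall y, rnorm (G (0 +i* y)) <= a) ->
    (forall y, rnorm (G (1 +i* y)) <= b) ->
    rnorm (G s%:C) <= K * (a + b).
Proof.
move=> s01; have /andP[s0 s1] := s01.
have sn0 : s != 0 by rewrite gt_eqF.
have s1n0 : 1 - s != 0 by rewrite subr_eq0 gt_eqF.
(* The vertical edges give [8 * (a / s) + 8 * (b / (1 - s))]; [kernel_rect_ge] costs [6 / (1 - s)],
   and returning from [G1] to [G] costs [1 + s <= 2]. *)
exists (96 / (s * (1 - s) ^+ 2)).
  by rewrite divr_gt0// mulr_gt0// exprn_gt0// subr_gt0.
move=> G a b Gh Ga Gb.
have a0 : 0 <= a := le_trans (rnorm_ge0 _) (Ga 0).
have b0 : 0 <= b := le_trans (rnorm_ge0 _) (Gb 0).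
pose k : C -> C := fun w => 1%:C * (1%:C + 1%:C * w)^-1.
pose G1 w := (k w : R[i]) *: G w.
have G1h : strip_holomorphic G1.
  apply: strip_holomorphicZ => //; apply: strip_holomorphic_inv => z.
  by rewrite /strip /= mul1r; lra.
have kE x y : cmod (k (x +i* y)) = (cmod ((1 + x) +i* y))^-1.
  by rewrite cmod_inv_affine normr1 !mul1r.
pose kap := cauchy_kernel s.
have kapE x y : cmod (kap (x +i* y)) = (cmod ((x - s) +i* y))^-1.
  by rewrite /kap kernelE cmodV.
have [_ _ /(_ s%:C s01)[q qc qE]] := G1h.
have rho_gt0 y : 0 < cmod (1 +i* y) :> R.
  by apply: lt_le_trans (cmod_geRe _); rewrite /= normr1.
suff key : (1 - s) / 6 * rnorm (G1 s%:C) <= 8 * (a / s) + 8 * (b / (1 - s)).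
  have GE : rnorm (G s%:C) = (1 + s) * rnorm (G1 s%:C).
    rewrite rnormZ -/(cmod _) -complexr0 kE complexr0.
    rewrite cmod_real gtr0_norm; last by lra.
    by rewrite mulrA mulfV ?mul1r// gt_eqF//; lra.
  have G1a : rnorm (G1 s%:C) <= 6 / (1 - s) * (8 * (a / s) + 8 * (b / (1 - s))).
    have -> : rnorm (G1 s%:C) = 6 / (1 - s) * ((1 - s) / 6 * rnorm (G1 s%:C)).
      by field; rewrite gt_eqF// subr_gt0.
    by rewrite ler_pM2l// divr_gt0// subr_gt0.
  rewrite GE; apply: (@le_trans _ _ (2 * rnorm (G1 s%:C))).
    by rewrite ler_wpM2r ?rnorm_ge0//; lra.
  rewrite -ler_pdivlMl//; apply: (le_trans G1a).
  have -> : 6 / (1 - s) * (8 * (a / s) + 8 * (b / (1 - s))) =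
     48 * (a * (1 - s) + b * s) / (s * (1 - s) ^+ 2).
    by field; rewrite sn0 s1n0.
  have -> : 2^-1 * (96 / (s * (1 - s) ^+ 2) * (a + b)) =
     48 * (a + b) / (s * (1 - s) ^+ 2).
    by field; rewrite sn0 s1n0.
  rewrite ler_pM2r ?invr_gt0 ?mulr_gt0 ?exprn_gt0 ?subr_gt0//; nra.
have [[M GM] _ _] := Gh.
have M0 : 0 <= M.
  by apply: le_trans (GM 0 _); rewrite ?rnorm_ge0// /strip /= lexx ler01.
(* A third of [e] goes to each horizontal edge and a third to the contour sum of [q]. *)
apply/ler_addgt0Pr => e e0.
have e3 : 0 < e / 3 by rewrite divr_gt0.
pose m := Num.bound (M / (e / 3)); pose L : R := m.+1%:R.
have L1 : 1 <= L by rewrite ler1n.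
have L0 : 0 < L by lra.
have ML : M <= e / 3 * L.
  rewrite mulrC -ler_pdivrMr//.
  apply: le_trans (ltW (archi_boundP _)) _; first by rewrite divr_ge0// ltW.
  by rewrite ler_nat.
have [N NP] := goursat_difference_quotient s01 G1h qc qE L0 e3.
pose n := maxn N (2 * m.+1).
have Ln : 2 * L <= 2 ^+ n.
  rewrite -natrM -natrX ler_nat.
  apply: (@leq_trans (2 ^ (2 * m.+1))); first exact/ltnW/ltn_expl.
  by rewrite leq_exp2l// leq_maxr.
have {NP} qe := NP n (leq_maxl _ _).
pose kG w := (kap w : R[i]) *: G1 w.
have rectE : rect_sum n q (0 +i* - L) 1%:C (0 +i* (2 * L)) =
    rect_sum n kG (0 +i* - L) 1%:C (0 +i* (2 * L)) -
    (rect_sum n kap (0 +i* - L) 1%:C (0 +i* (2 * L)) : R[i]) *: G1 s%:C.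
  have qK := difference_quotient_kernel qE.
  rewrite (@eq_rect_sum _ _ _ _
    (fun w => kG w - (kap w : R[i]) *: G1 s%:C)) ?mulr_ge0 ?(ltW L0)//.
  - rewrite rect_sumB; congr (_ - _).
    by rewrite /rect_sum !edge_sumZl scalerDl !scalerBl.
  - move=> t _; split; rewrite qK ?scalerBr// eq_complex /= negb_and.
      by rewrite lt_eqF.
    by rewrite add0r gt_eqF.
  - move=> t _; split; rewrite qK ?scalerBr// eq_complex /= negb_and.
      by rewrite oppr_eq0 (gt_eqF L0) orbT.
    by rewrite (_ : - L + 2 * L = L) ?(gt_eqF L0) ?orbT//; ring.
have kGE x y : rnorm (kG (x +i* y)) = rnorm (G (x +i* y)) /
    (cmod ((x - s) +i* y) * cmod ((1 + x) +i* y)).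
  by rewrite /kG /G1 scalerA rnormZ -/(cmod _) cmodM kE kapE -invfM mulrC.
have rhoE y : cmod (1 +i* y) ^+ 2 = 1 + y ^+ 2 by rewrite cmodE expr1n.
have kG0 y : rnorm (kG (0 +i* y)) <= a / s / (1 + y ^+ 2).
  rewrite kGE addr0 sub0r -rhoE -[a / s / _]mulrA -invfM.
  apply: ler_pM; rewrite ?rnorm_ge0 ?invr_ge0 ?mulr_ge0 ?cmod_ge0//.
  rewrite lef_pV2 ?posrE.
  - rewrite expr2 mulrA ler_pM2r ?rho_gt0//.
    rewrite -[X in X * _ <= _](gtr0_norm s0) -cmod_real -cmodM.
    have -> : s%:C * (1 +i* y) = s +i* (s * y).
      by apply/eqP; rewrite eq_complex /=; apply/andP; split; apply/eqP; ring.
    by apply: cmod_mono; rewrite ?sqrrN// exprMn ler_piMl ?sqr_ge0 ?exprn_ile1 ?ltW.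
  - rewrite mulr_gt0 ?rho_gt0//; apply: lt_le_trans (cmod_geRe _).
    by rewrite /= normrN gtr0_norm.
  - by rewrite mulr_gt0// exprn_gt0// rho_gt0.
have kG1 y : rnorm (kG (1 +i* y)) <= b / (1 - s) / (1 + y ^+ 2).
  rewrite kGE -rhoE -[b / (1 - s) / _]mulrA -invfM.
  have s1' : 0 < 1 - s by rewrite subr_gt0.
  have p1 : 0 < cmod ((1 - s) +i* y).
    by apply: lt_le_trans (cmod_geRe _); rewrite /= gtr0_norm.
  have p2 : cmod (1 +i* y) <= cmod ((1 + 1) +i* y).
    by apply: cmod_mono => //; lra.
  apply: ler_pM; rewrite ?rnorm_ge0 ?invr_ge0 ?mulr_ge0 ?cmod_ge0//.
  rewrite lef_pV2 ?posrE.
  - rewrite expr2 mulrA; apply: ler_pM => //; rewrite ?mulr_ge0 ?cmod_ge0 ?(ltW s1')//.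
    rewrite -[X in X * _ <= _](gtr0_norm s1') -cmod_real -cmodM.
    have -> : (1 - s)%:C * (1 +i* y) = (1 - s) +i* ((1 - s) * y).
      by apply/eqP; rewrite eq_complex /=; apply/andP; split; apply/eqP; ring.
    apply: cmod_mono => //; rewrite exprMn ler_piMl ?sqr_ge0//.
    by rewrite exprn_ile1 ?(ltW s1')// gerBl ltW.
  - by rewrite mulr_gt0//; apply: lt_le_trans p2; exact: rho_gt0.
  - by rewrite mulr_gt0// exprn_gt0// rho_gt0.
have kGh (y : R) : `|y| = L -> rnorm (edge_sum n kG (0 +i* y) 1%:C) <= e / 3.
  move=> yL; rewrite -[X in _ <= X]mul1r -[X in _ <= X * _](normr1 R) -cmod_real.
  apply: edge_sum_le => t t01.
  rewrite -rmorphM addc_real add0r mulr1 kGE ler_pdivrMr.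
    apply: (@le_trans _ _ M); first by apply: GM; rewrite /strip /=.
    apply: (le_trans ML); rewrite ler_pM2l// -[L]mulr1.
    apply: ler_pM; rewrite ?ler01 ?(ltW L0)//.
    - by rewrite -yL; apply: le_trans (cmod_geIm _).
    - by apply: le_trans (cmod_geRe _); rewrite /= ger0_norm; lra.
  rewrite mulr_gt0//.
    by apply: lt_le_trans (cmod_geIm _); rewrite /= yL.
  by apply: lt_le_trans (cmod_geRe _); rewrite /= ger0_norm; lra.
have gam c : 0 <= c -> 4 * c * (gamma (- L + 2 * L) - gamma (- L)) <= 8 * c.
  move=> c0; have := gamma_lt1 (- L + 2 * L); have := gamma_lt1 (- L).
  by rewrite !ler_norml => /andP[g1 _] /andP[_ g2]; nra.
have L2 : 0 < 2 * L <= 2 ^+ n by rewrite Ln andbT mulr_gt0.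
have lft := le_trans (vertical_edge_sum_le (- L) kG0 L2) (gam _ (divr_ge0 a0 (ltW s0))).
have s1' : 0 <= 1 - s by rewrite subr_ge0 ltW.
have rgt := le_trans (vertical_edge_sum_le (- L) kG1 L2) (gam _ (divr_ge0 b0 s1')).
have bot : rnorm (edge_sum n kG (0 +i* - L) 1%:C) <= e / 3.
  by apply: kGh; rewrite normrN gtr0_norm.
have top : rnorm (edge_sum n kG (0 +i* L) 1%:C) <= e / 3.
  by apply: kGh; rewrite gtr0_norm.
have kGB : rnorm (rect_sum n kG (0 +i* - L) 1%:C (0 +i* (2 * L))) <=
    2 * (e / 3) + 8 * (a / s) + 8 * (b / (1 - s)).
  rewrite /rect_sum addc_imag addc_real add0r.
  have -> : - L + 2 * L = L by ring.
  apply: (le_trans (rnormD _ _)).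
  by apply: (le_trans (lerD (rnormB _ _) (rnormB _ _))); lra.
have := @kernel_rect_ge _ s s01 L n L1 Ln.
move=> /(ler_wpM2r (rnorm_ge0 (G1 s%:C)))/le_trans; apply.
rewrite -[_ * _]rnormZ.
have -> : (rect_sum n kap (0 +i* - L) 1%:C (0 +i* (2 * L)) : R[i]) *: G1 s%:C =
    rect_sum n kG (0 +i* - L) 1%:C (0 +i* (2 * L)) -
    rect_sum n q (0 +i* - L) 1%:C (0 +i* (2 * L)).
  by rewrite rectE opprB addrC subrK.
by apply: (le_trans (rnormB _ _)); lra.
Qed.

End ThreeLinesEstimate.

(** * Operations on strip functions; three lines with a free exponent *)

Section StripStability.
Context {R : realType}.
Local Notation C := R[i]^o.

Lemma strip_holomorphic_affine {V : normedModType R[i]} (G : C -> V) (c d : R[i]) :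
  (forall z, strip z -> strip (d + c * z)) ->
  (forall z : C, 0 < complex.Re z < 1 -> 0 < complex.Re (d + c * z) < 1) ->
  strip_holomorphic G -> strip_holomorphic (fun w => G (d + c * w)).
Proof.
move=> Sc Ic [[M GM] Gc Gd]; split.
- by exists M => z /Sc; exact: GM.
- move=> z Sz; apply/(cvg_rnormP (F := within strip (nbhs z))) => e e0.
  have /cvg_rnormP/(_ e e0)/nbhs_rnormP[r r0 rG] := Gc _ (Sc _ Sz).
  apply/nbhs_rnormP; exists (r / (cmod c + 1)).
    by rewrite divr_gt0// ltr_wpDl// cmod_ge0.
  move=> w wz Sw; apply: rG (Sc _ Sw).
  have -> : (d + c * w : C) - (d + c * z) = (c *: (w - z : C) : C).
    by rewrite /GRing.scale /=; ring.
  rewrite rnormZ -/(cmod _); apply: (@le_lt_trans _ _ ((cmod c + 1) * rnorm (w - z))).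
    by rewrite ler_wpM2r ?rnorm_ge0// lerDl.
  by rewrite mulrC -ltr_pdivlMr// ltr_wpDl// cmod_ge0.
- move=> z /Ic Iz; have [q qc qE] := Gd _ Iz.
  exists (fun w => c *: q (d + c * w)); last first.
    by move=> w; rewrite qE scalerA; congr (_ + _ *: _); ring.
  have qc' : q (d + c * w) @[w --> z] --> q (d + c * z).
    exact: (cvg_comp _ _ (cdiff_continuous (cdiff_affine d c z)) qc).
  exact: (@cvgZl_tmp _ _ _ (nbhs z) _ c (fun w => q (d + c * w)) _ qc').
Qed.

Lemma strip_holomorphic_linear {V W : normedModType R[i]} (T : V -> W) (c : R)
    (G : C -> V) : linear T -> (forall v, rnorm (T v) <= c * rnorm v) ->
  strip_holomorphic G -> strip_holomorphic (fun w => T (G w)).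
Proof.
move=> Tl Tc [[M GM] Gc Gd].
have TB u v : T (u - v) = T u - T v.
  by rewrite addrC -scaleN1r Tl scaleN1r addrC.
have c1 : 0 < `|c| + 1 by rewrite ltr_wpDl.
have Tc' v : rnorm (T v) <= (`|c| + 1) * rnorm v.
  apply: (le_trans (Tc v)); rewrite ler_wpM2r ?rnorm_ge0//.
  by apply: (le_trans (ler_norm c)); rewrite lerDl.
have Tcvg (F : set_system C) (FF : Filter F) (f : C -> V) l :
    f w @[w --> F] --> l -> T (f w) @[w --> F] --> T l.
  move=> /cvg_rnormP fl; apply/(cvg_rnormP (F := F)) => e e0.
  have /fl : 0 < e / (`|c| + 1) by rewrite divr_gt0.
  apply: filterS => w; rewrite -TB ler_pdivlMr// mulrC => fw.
  exact: le_trans (Tc' _) fw.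
split.
- exists ((`|c| + 1) * M) => z /GM Gz; apply: (le_trans (Tc' _)).
  by rewrite ler_wpM2l// ltW.
- by move=> z /Gc; exact: (Tcvg (within strip (nbhs z))).
- move=> z /Gd[q qc qE]; exists (fun w => T (q w)).
    exact: (Tcvg (nbhs z)).
  by move=> w; rewrite qE addrC Tl addrC.
Qed.

Lemma strip_holomorphic_line {V : normedModType R[i]} (G : C -> V) (x : R) :
  0 <= x <= 1 -> strip_holomorphic G -> continuous (fun t : R => G (x +i* t)).
Proof.
move=> x01 [_ Gc _] t; apply/(cvg_rnormP (F := nbhs t)) => e e0.
have /cvg_rnormP/(_ e e0)/nbhs_rnormP[r r0 rG] := Gc (x +i* t) x01.
apply/nbhs_normP; exists r => //= t' tt'; apply: rG => //.
have -> : (x +i* t' : C) - (x +i* t) = 0 +i* (t' - t).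
  by apply/eqP; rewrite eq_complex /= subrr !eqxx.
by rewrite [rnorm _]cmod_imag distrC.
Qed.

(** The factor [((1 + s) / (1 + z)) ^ m] is 1 at [s] and gives the two weights on the boundary
    lines. Since [(1 + s) / 2 < 1] and [K] does not depend on [m], a large [m] and then a small [a]
    make the bound small, which is all that is needed of the classical [a ^ (1 - s) * b ^ s]. *)
Lemma three_lines {V : normedModType R[i]} (s : R) : 0 < s < 1 ->
  exists2 K : R, 0 < K &
  forall (G : C -> V) (a b : R) m t, strip_holomorphic G ->
    (forall y, rnorm (G (0 +i* y)) <= a) ->
    (forall y, rnorm (G (1 +i* y)) <= b) ->
    rnorm (G (s +i* t)) <= K * (a * (1 + s) ^+ m + b * ((1 + s) / 2) ^+ m).
Proof.
move=> s01; have [K K0 KP] := @three_lines_weak R V s s01.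
have /andP[s0 s1] := s01.
exists K => // G a b m t Gh Ga Gb.
pose k : C -> C := fun w => (1 + s)%:C * (1%:C + 1%:C * w)^-1.
pose G2 w := (k w ^+ m : R[i]) *: G ((0 +i* t) + 1 * w).
have G2h : strip_holomorphic G2.
  apply: strip_holomorphicZ.
    apply: strip_holomorphicX; apply: strip_holomorphic_inv => z.
    by rewrite /strip /= mul1r; lra.
  apply: strip_holomorphic_affine => // -[x y]; rewrite /strip /=.
    by rewrite mul1r mul0r subr0 add0r.
  by rewrite mul1r mul0r subr0 add0r.
have kE x y : cmod (k (x +i* y)) = (1 + s) / cmod ((1 + x) +i* y).
  by rewrite cmod_inv_affine ger0_norm ?mul1r//; lra.
have shiftE x y : (0 +i* t) + 1 * (x +i* y) = x +i* (t + y).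
  by rewrite mul1r; apply/eqP; rewrite eq_complex /= add0r !eqxx.
have a0 : 0 <= a := le_trans (rnorm_ge0 _) (Ga 0).
have b0 : 0 <= b := le_trans (rnorm_ge0 _) (Gb 0).
have kx (x y : R) : 0 <= x -> cmod (k (x +i* y)) <= (1 + s) / (1 + x).
  move=> x0; rewrite kE ler_pM2l; last by lra.
  have cx : 1 + x <= cmod ((1 + x) +i* y).
    by apply: le_trans (cmod_geRe _); rewrite /= ler_norm.
  by rewrite lef_pV2// posrE; lra.
have -> : G (s +i* t) = G2 s%:C.
  rewrite /G2 -complexr0 shiftE addr0 complexr0.
  have -> : k s%:C = 1.
    rewrite /k -rmorphM -rmorphD -fmorphV -rmorphM mul1r mulfV//.
    by rewrite gt_eqF//; lra.
  by rewrite expr1n scale1r.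
apply: KP => // y; rewrite /G2 shiftE rnormZ -/(cmod _) cmodX mulrC.
  apply: ler_pM; rewrite ?rnorm_ge0 ?exprn_ge0 ?cmod_ge0//.
  apply: lerXn2r; rewrite ?nnegrE ?cmod_ge0//; first by lra.
  by have := @kx 0 y (lexx 0); rewrite addr0 divr1.
apply: ler_pM; rewrite ?rnorm_ge0 ?exprn_ge0 ?cmod_ge0//.
apply: lerXn2r; rewrite ?nnegrE ?cmod_ge0//; first by rewrite divr_ge0//; lra.
exact: (@kx 1 y ler01).
Qed.

End StripStability.

(** * The Calderon space: norm, construction of elements, transfer *)

Section Calderon.
Context {R : realType} {X Y : completeNormedModType R[i]}.
Local Notation C := R[i]^o.

Lemma rnorm_continuous {V : normedModType R[i]} (f : R -> V) :
  continuous f -> continuous (fun t => rnorm (f t)).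
Proof.
move=> fc t; apply/cvgrPdist_le => e e0.
have /cvg_rnormP/(_ e e0) := fc t; apply: filterS => t' ft.
rewrite ler_norml; apply/andP; split.
  rewrite lerBrDl; have := rnormD (f t' - f t) (f t); rewrite subrK; lra.
have := rnormD (f t - f t') (f t'); rewrite subrK rdistC; lra.
Qed.

Section Norm.
Variable i : X -> Y.
Implicit Types F : calderon i.

Lemma strip_holomorphic_cfun F : strip_holomorphic (cfun F).
Proof.
split; first exact: cfun_bounded.
  by apply/subspace_continuousP; exact: cfun_continuous.
by move=> z z01; apply/derivable_cdiff; exact: cfun_holomorphic.
Qed.

(** [cfun_bounded] controls the norm of [Y] only, while the [sup] in [calderon_norm] dominates the
    values only if they are bounded in [X]. The limits at infinity and the extreme value theorem
    provide this. *)
Lemma ctrace_bounded F : exists M : R, forall t, rnorm (ctrace F t) <= M.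
Proof.
have [/cvg_rnormP/(_ _ ltr01)[a [_ aP]] /cvg_rnormP/(_ _ ltr01)[b [_ bP]]] :=
  (ctrace_pinfty F, ctrace_ninfty F).
(* The thresholds [b] at -oo and [a] at +oo need not be ordered. *)
pose l := Num.min b a; pose r := Num.max b a.
have lr : l <= r by rewrite /l ge_min /r le_max lexx.
have [|c _ cP] := @EVT_max _ (fun t => rnorm (ctrace F t)) l r lr.
  by apply: continuous_subspaceT; apply: rnorm_continuous; exact: ctrace_continuous.
exists (Num.max 1 (rnorm (ctrace F c))) => t; rewrite le_max.
have [ta|ta] := ltP a t; first by rewrite -[ctrace F t]subr0 aP.
have [tb|tb] := ltP t b; first by rewrite -[ctrace F t]subr0 bP.
by rewrite cP ?orbT// in_itv /= /l /r ge_min tb le_max ta orbT.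
Qed.

Lemma ctrace_le_norm F t : rnorm (ctrace F t) <= calderon_norm F.
Proof.
have [M MP] := ctrace_bounded F.
rewrite le_max; apply/orP; left; apply: ub_le_sup; last by exists t.
by exists M => _ [t' _ <-].
Qed.

Lemma cfun1_le_norm F t : rnorm (cfun F (1 +i* t)) <= calderon_norm F.
Proof.
have [M MP] := cfun_bounded F.
rewrite le_max; apply/orP; right; apply: ub_le_sup; last by exists t.
by exists M => _ [t' _ <-]; apply: MP; rewrite /strip /= lexx ler01.
Qed.

Lemma calderon_norm_ge0 F : 0 <= calderon_norm F.
Proof. exact: le_trans (rnorm_ge0 _) (ctrace_le_norm F 0). Qed.

Lemma calderon_norm_le F a b :
  (forall t, rnorm (ctrace F t) <= a) ->
  (forall t, rnorm (cfun F (1 +i* t)) <= b) ->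
  calderon_norm F <= Num.max a b.
Proof.
move=> Fa Fb; rewrite ge_max !le_max; apply/andP; split; apply/orP.
  left; apply: ge_sup; first by exists (rnorm (ctrace F 0)), 0.
  by move=> _ [t _ <-].
right; apply: ge_sup; first by exists (rnorm (cfun F (1 +i* 0))), 0.
by move=> _ [t _ <-].
Qed.

End Norm.

Lemma calderon_of_strip (i : X -> Y) (G : C -> Y) (g : R -> X) :
  strip_holomorphic G -> (forall t, i (g t) = G (0 +i* t)) -> continuous g ->
  (forall e : R, 0 < e -> exists M : R, forall t, M < `|t| ->
     rnorm (g t) <= e /\ rnorm (G (1 +i* t)) <= e) ->
  exists F : calderon i, cfun F = G /\ ctrace F = g.
Proof.
move=> Gh giE gc decay; have [Gb Gc Gd] := Gh.
have Gc' : {within strip, continuous G} by apply/subspace_continuousP.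
have Gd' (z : C) : 0 < complex.Re z < 1 -> derivable G z 1.
  by move=> /Gd/derivable_cdiff.
have p1 : g t @[t --> +oo] --> (0 : X).
  apply/cvg_rnormP => e /decay[M MP]; exists M; split; first exact: num_real.
  by move=> t Mt; rewrite subr0; have [] := MP t (lt_le_trans Mt (ler_norm t)).
have n1 : g t @[t --> -oo] --> (0 : X).
  apply/cvg_rnormP => e /decay[M MP]; exists (- M); split; first exact: num_real.
  move=> t Mt; rewrite subr0; have [] := MP t => //.
  by rewrite -normrN; apply: lt_le_trans (ler_norm _); rewrite ltrNr.
have p2 : G (1 +i* t) @[t --> +oo] --> (0 : Y).
  apply/cvg_rnormP => e /decay[M MP]; exists M; split; first exact: num_real.
  by move=> t Mt; rewrite subr0; have [] := MP t (lt_le_trans Mt (ler_norm t)).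
have n2 : G (1 +i* t) @[t --> -oo] --> (0 : Y).
  apply/cvg_rnormP => e /decay[M MP]; exists (- M); split; first exact: num_real.
  move=> t Mt; rewrite subr0; have [] := MP t => //.
  by rewrite -normrN; apply: lt_le_trans (ler_norm _); rewrite ltrNr.
have c1 : continuous (fun t : R => G (1 +i* t)).
  by apply: strip_holomorphic_line => //; rewrite ler01 lexx.
by exists (Calderon Gb Gc' Gd' giE gc p1 n1 c1 p2 n2).
Qed.

Lemma calderon_decay (i : X -> Y) (F : calderon i) (e : R) : 0 < e ->
  exists M : R, forall t, M < `|t| -> rnorm (ctrace F t) <= e.
Proof.
move=> e0.
have [/cvg_rnormP/(_ _ e0)[a [_ aP]] /cvg_rnormP/(_ _ e0)[b [_ bP]]] :=
  (ctrace_pinfty F, ctrace_ninfty F).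
exists (Num.max `|a| `|b|) => t; rewrite gt_max => /andP[ta tb].
have [t0|t0] := lerP 0 t.
  rewrite -[ctrace F t]subr0; apply: aP.
  by apply: le_lt_trans (ler_norm a) _; rewrite -(ger0_norm t0).
rewrite -[ctrace F t]subr0; apply: bP.
by have := ler_norm (- b); rewrite normrN; move: tb; rewrite (ltr0_norm t0); lra.
Qed.

Section Transfer.
Variables (i : {linear X -> Y}) (DX : X -> X) (DY : Y -> Y) (cX cY : R).
Hypotheses (DX_linear : linear DX) (DY_linear : linear DY).
Hypothesis (cX_gt0 : 0 < cX).
Hypotheses (DX_le : forall f, rnorm (DX f) <= cX * rnorm f)
           (DY_le : forall f, rnorm (DY f) <= cY * rnorm f).
Hypothesis (i_comm : forall f, i (DX f) = DY (i f)).

(** The exponent is [k.+1] because one factor must be kept for decay on Re z = 1: the values there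
    come from the interior line Re = s, where only the bound [b] is given. On Re z = 0 the decay is
    that of [ctrace F]. *)
Lemma calderon_transfer (theta beta : R) :
  0 < theta -> theta < beta -> beta < 1 ->
  let s := theta / beta in
  forall (F : calderon i) (k : nat) (b : R),
  (forall t, rnorm (DY (cfun F (s +i* t))) <= b) ->
  exists2 H : calderon i, cfun H beta%:C = DY (cfun F theta%:C) &
    calderon_norm H <=
      Num.max (((2 - beta) / 2) ^+ k.+1 * (cX * calderon_norm F))
              ((2 - beta) ^+ k.+1 * b).
Proof.
move=> theta0 thbe beta1 s F k b Fb.
have beta0 : 0 < beta by exact: lt_trans thbe.
have s0 : 0 < s by rewrite divr_gt0.
have s1 : s < 1 by rewrite ltr_pdivrMr// mul1r.
have b2 : 1 <= 2 - beta by lra.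
pose f : C -> C := fun w => (2 - beta)%:C * (2%:C + (-1)%:C * w)^-1.
have fh : strip_holomorphic f.
  by apply: strip_holomorphic_inv => z; rewrite /strip /=; lra.
have fE x y : cmod (f (x +i* y)) = (2 - beta) / cmod ((2 - x) +i* - y).
  by rewrite cmod_inv_affine ger0_norm ?mulN1r//; lra.
have fx x y : x < 2 -> cmod (f (x +i* y)) <= (2 - beta) / (2 - x).
  move=> x2; rewrite fE ler_pM2l; last by lra.
  have cx : 2 - x <= cmod ((2 - x) +i* - y).
    by apply: le_trans (cmod_geRe _); rewrite /= ler_norm.
  by rewrite lef_pV2// posrE; lra.
pose phi w := f w ^+ k.+1.
pose G w : Y := (phi w : R[i]) *: DY (cfun F (0 + s%:C * w)).
pose g t : X := (phi (0 +i* t) : R[i]) *: DX (ctrace F (s * t)).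
have Gh : strip_holomorphic G.
  apply: strip_holomorphicZ; first exact: strip_holomorphicX.
  apply: (strip_holomorphic_linear DY_linear DY_le).
  apply: (@strip_holomorphic_affine _ _ (cfun F)).
  - move=> [x y]; rewrite /strip /= mul0r subr0 add0r => /andP[x0 x1].
    by apply/andP; split; nra.
  - move=> [x y] /=; rewrite mul0r subr0 add0r => /andP[x0 x1].
    by apply/andP; split; nra.
  - exact: strip_holomorphic_cfun.
have scE x y : 0 + s%:C * (x +i* y) = (s * x) +i* (s * y).
  by rewrite add0r; apply/eqP; rewrite eq_complex /=; apply/andP; split;
     apply/eqP; ring.
have giE t : i (g t) = G (0 +i* t).
  by rewrite linearZ /= i_comm ctraceE /G scE mulr0.
have DXB u v : DX (u - v) = DX u - DX v.
  by rewrite addrC -scaleN1r DX_linear scaleN1r addrC.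
have gc : continuous g.
  move=> t; apply: (cvgZ (F := nbhs t)).
    apply: (@strip_holomorphic_line _ C phi 0); first by rewrite lexx ler01.
    exact: strip_holomorphicX.
  apply/(cvg_rnormP (F := nbhs t)) => e e0.
  have e1 : 0 < e / cX by rewrite divr_gt0.
  have sc : (s * u) @[u --> t] --> s * t by exact: mulrl_continuous.
  have := cvg_comp _ _ sc (@ctrace_continuous _ _ _ _ F (s * t)).
  move=> /cvg_rnormP/(_ _ e1); apply: filterS => u /= ut.
  rewrite -DXB; apply: (le_trans (DX_le _)).
  by rewrite mulrC -ler_pdivlMr.
have gle t : rnorm (g t) <=
    ((2 - beta) / 2) ^+ k.+1 * (cX * rnorm (ctrace F (s * t))).
  rewrite rnormZ -/(cmod _) cmodX; apply: ler_pM => //.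
  - by rewrite exprn_ge0// cmod_ge0.
  - exact: rnorm_ge0.
  - apply: lerXn2r; rewrite ?nnegrE ?cmod_ge0//; first by rewrite divr_ge0//; lra.
    by have := @fx 0 t; rewrite subr0; apply.
have Gle t : rnorm (G (1 +i* t)) <= (2 - beta) ^+ k * (cmod (f (1 +i* t)) * b).
  rewrite rnormZ -/(cmod _) cmodX exprSr -mulrA scE mulr1.
  apply: ler_pM; rewrite ?exprn_ge0 ?mulr_ge0 ?rnorm_ge0 ?cmod_ge0//.
    apply: lerXn2r; rewrite ?nnegrE ?cmod_ge0//; first by lra.
    have := @fx 1 t; rewrite (_ : 2 - 1 = 1 :> R) ?divr1; last by ring.
    by apply; lra.
  by rewrite ler_wpM2l ?cmod_ge0.
have b0 : 0 <= b := le_trans (rnorm_ge0 _) (Fb 0).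
have decay (e : R) : 0 < e -> exists M : R, forall t, M < `|t| ->
    rnorm (g t) <= e /\ rnorm (G (1 +i* t)) <= e.
  move=> e0; pose c := ((2 - beta) / 2) ^+ k.+1 * cX.
  have c0 : 0 < c by rewrite mulr_gt0// exprn_gt0// divr_gt0//; lra.
  have [M MP] := calderon_decay F (divr_gt0 e0 c0).
  pose B := (2 - beta) ^+ k.+1 * b.
  have B0 : 0 <= B by rewrite mulr_ge0// exprn_ge0//; lra.
  (* The first threshold is for the trace, which is read at [s * t]; the second makes [B / |t|] at
     most [e]. *)
  exists (Num.max (`|M| / s) (B / e)) => t; rewrite gt_max => /andP[Mt Bt].
  split.
    apply: (le_trans (gle t)); rewrite mulrA -/c mulrC -ler_pdivlMr//.
    apply: MP; apply: le_lt_trans (ler_norm M) _.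
    by rewrite normrM (gtr0_norm s0) mulrC -ltr_pdivrMr.
  have t0 : 0 < `|t| by apply: le_lt_trans Bt; rewrite divr_ge0// ltW.
  have ct : `|t| <= cmod ((2 - 1) +i* - t).
    by apply: le_trans (cmod_geIm _); rewrite /= normrN.
  apply: (le_trans (Gle t)); rewrite fE.
  apply: (@le_trans _ _ (B / `|t|)).
    rewrite /B exprSr -!mulrA ler_wpM2l ?exprn_ge0//; try lra.
    rewrite ler_wpM2l//; first by lra.
    by rewrite mulrC ler_wpM2l// lef_pV2// posrE; exact: lt_le_trans ct.
  by rewrite ler_pdivrMr// mulrC -ler_pdivrMr// ltW.
have [H [HG Hg]] := calderon_of_strip Gh giE gc decay.
exists H.
  rewrite HG /G add0r -rmorphM /s divfK ?gt_eqF//.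
  have -> : phi beta%:C = 1.
    rewrite /phi /f -rmorphM -rmorphD -fmorphV -rmorphM mulN1r mulfV ?expr1n//.
    by rewrite gt_eqF//; lra.
  by rewrite scale1r.
apply: calderon_norm_le => t; rewrite ?HG ?Hg.
  apply: (le_trans (gle t)); rewrite ler_wpM2l//.
    by rewrite exprn_ge0// divr_ge0//; lra.
  by rewrite ler_wpM2l ?ctrace_le_norm// ltW.
apply: (le_trans (Gle t)); rewrite exprSr -mulrA ler_wpM2l ?exprn_ge0//.
  by lra.
rewrite ler_wpM2r//; have := @fx 1 t.
by rewrite (_ : 2 - 1 = 1 :> R) ?divr1; [apply; lra|ring].
Qed.

End Transfer.
End Calderon.

(** * Operator norms between interpolation spaces *)

Section Operators.
Context {R : realType}.

Lemma rnorm_le_op_norm {X Y : normedModType R[i]} (T : X -> Y) (c : R) :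
  bounded_operator (whole X) (whole Y) T ->
  (op_norm (whole X) (whole Y) T <= c%:E)%E ->
  forall f, rnorm (T f) <= c * rnorm f.
Proof.
move=> [_ Tl _] Tc.
have T0 : T 0 = 0.
  have := Tl 1 0 0 I I; rewrite !scale1r addr0 => /eqP.
  by rewrite -subr_eq0 opprD addrA subrr add0r oppr_eq0 => /eqP.
have TZ a u : T (a *: u) = a *: T u.
  by have := Tl a u 0 I I; rewrite addr0 T0 addr0.
move=> f; have [->|f0] := eqVneq f 0; first by rewrite T0 !rnorm0 mulr0.
have fp : 0 < rnorm f.
  rewrite lt_neqAle rnorm_ge0 andbT eq_sym; apply: contra f0 => /eqP.
  by move=> /rnorm_eq0 ->.
have cf : cmod ((rnorm f)^-1%:C) = (rnorm f)^-1.
  by rewrite cmod_real ger0_norm// invr_ge0 ltW.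
have : ((rnorm (T ((rnorm f)^-1%:C *: f)))%:E <= c%:E)%E.
  apply: le_trans Tc; apply: ereal_sup_ubound.
  exists ((rnorm f)^-1%:C *: f) => //; split=> //=.
  by rewrite rnormZ -/(cmod _) cf mulVf// gt_eqF.
by rewrite lee_fin TZ rnormZ -/(cmod _) cf mulrC ler_pdivrMr.
Qed.

Lemma exists_geometric_le (c q e : R) : 0 <= q < 1 -> 0 < e ->
  exists k : nat, c * q ^+ k <= e.
Proof.
move=> /andP[q0 q1] e0.
have q1' : `|q| < 1 by rewrite ger0_norm.
have /cvgrPdist_le/(_ e e0)[k _ kP] := @cvg_geometric R c q q1'.
exists k; have := kP k (leqnn k); rewrite sub0r normrN.
exact: le_trans (ler_norm _).
Qed.

Section Interpolation.
Context {X Y : completeNormedModType R[i]}.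

(** The infimum in the quotient norm need not be attained; a point of the unit ball has a
    representative of norm below 1 + 1, whence the factor 2. *)
Lemma interpolation_op_norm_le (i : X -> Y) (D : Y -> Y) (theta beta S : R) :
  linear D -> 0 <= S ->
  (forall F : calderon i, exists2 H : calderon i,
     cfun H beta%:C = D (cfun F theta%:C) &
     calderon_norm H <= S * calderon_norm F) ->
  bounded_operator (interpolation_space i theta) (interpolation_space i beta) D /\
  (op_norm (interpolation_space i theta) (interpolation_space i beta) D
     <= (2 * S)%:E)%E.
Proof.
move=> Dl S0 FH.
have lb t y : has_lbound
    [set calderon_norm F | F in [set F : calderon i | cfun F t = y]].
  by exists 0 => _ [F _ <-]; exact: calderon_norm_ge0.
have opS : (op_norm (interpolation_space i theta) (interpolation_space i beta) D
     <= (2 * S)%:E)%E.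
  apply: ge_ereal_sup => _ [y [[F0 F0y] y1] <-]; rewrite lee_fin /=.
  have [||_ [F Fy <-]] := @inf_adherent _
     [set calderon_norm F | F in [set F : calderon i | cfun F theta%:C = y]] 1.
  - exact: ltr01.
  - by split; [exists (calderon_norm F0), F0|exact: lb].
  move=> Flt; have [H Hy HS] := FH F.
  apply: le_trans (le_trans HS _); last first.
    by rewrite mulrC ler_wpM2r//; apply: ltW; apply: lt_le_trans Flt _;
       move: y1 => /=; lra.
  by apply: ge_inf; [exact: lb|exists H => //=; rewrite Hy Fy].
split=> //; split.
- by move=> _ [F <-]; have [H Hy _] := FH F; exists H.
- by move=> a u v _ _; exact: Dl.
- by apply: le_lt_trans opS _; rewrite ltry.
Qed.

(** On Re = 0 the function [DY F] is [i (DX (ctrace F))]; this is where smallness [e] of the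
    operator [i DX] enters the three lines estimate. *)
Lemma interpolation_transfer (i : {linear X -> Y}) (DX : X -> X) (DY : Y -> Y)
    (cX cY theta beta : R) : linear DX -> linear DY -> 0 < cX -> 0 < cY ->
  (forall f, rnorm (DX f) <= cX * rnorm f) ->
  (forall f, rnorm (DY f) <= cY * rnorm f) ->
  (forall f, i (DX f) = DY (i f)) ->
  0 < theta -> theta < beta -> beta < 1 ->
  let s := theta / beta in forall K e S (k m : nat),
  (forall (G : R[i]^o -> Y) (a b : R) m t, strip_holomorphic G ->
    (forall y, rnorm (G (0 +i* y)) <= a) ->
    (forall y, rnorm (G (1 +i* y)) <= b) ->
    rnorm (G (s +i* t)) <= K * (a * (1 + s) ^+ m + b * ((1 + s) / 2) ^+ m)) ->
  (forall f, rnorm (i (DX f)) <= e * rnorm f) ->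
  ((2 - beta) / 2) ^+ k.+1 * cX <= S ->
  (2 - beta) ^+ k.+1 * (K * (e * (1 + s) ^+ m + cY * ((1 + s) / 2) ^+ m)) <= S ->
  0 <= e ->
  forall F : calderon i, exists2 H : calderon i,
     cfun H beta%:C = DY (cfun F theta%:C) &
     calderon_norm H <= S * calderon_norm F.
Proof.
move=> DXl DYl cX0 cY0 DXc DYc iD th0 thbe be1 s K e S k m KP ie S1 S2 e0 F.
pose N := calderon_norm F; have N0 : 0 <= N := calderon_norm_ge0 F.
have [|H Hy HN] := @calderon_transfer _ _ _ i DX DY cX cY DXl DYl cX0 DXc DYc iD
    _ _ th0 thbe be1 F k
    (K * (e * N * (1 + s) ^+ m + cY * N * ((1 + s) / 2) ^+ m)).
  move=> t; apply: (KP (fun w => DY (cfun F w))).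
  - apply: (strip_holomorphic_linear DYl DYc); exact: strip_holomorphic_cfun.
  - move=> y; rewrite -ctraceE -iD; apply: (le_trans (ie _)).
    by rewrite ler_wpM2l// ctrace_le_norm.
  - move=> y; apply: (le_trans (DYc _)).
    by rewrite ler_wpM2l ?cfun1_le_norm// ltW.
exists H => //; apply: (le_trans HN); rewrite ge_max mulrA ler_wpM2r//=.
apply: le_trans (ler_wpM2r N0 S2); rewrite le_eqVlt; apply/orP; left.
by apply/eqP; ring.
Qed.

End Interpolation.
End Operators.

Theorem proposition11 (R : realType) (d : measure_display)
    (Omega : measurableType d) (mu : {measure set Omega -> \bar R})
    (X Y : completeNormedModType R[i])
    (DeltaX : set Omega -> X -> X) (DeltaY : set Omega -> Y -> Y)
    (hX : is_function_space mu DeltaX) (hY : is_function_space mu DeltaY)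
    (i : {linear X -> Y})
    (i_ac : absolutely_continuous_op (whole X) (whole Y) mu DeltaX i)
    (i_inj : injective i) (i_dense : dense (range i))
    (i_Delta : forall A f, measurable A -> i (DeltaX A f) = DeltaY A (i f))
    (theta beta : R) (theta_gt0 : 0 < theta) (theta_lt_beta : theta < beta)
    (beta_lt1 : beta < 1) :
  absolutely_continuous_op
    (interpolation_space i theta) (interpolation_space i beta) mu DeltaY id.
Proof.
pose s := theta / beta.
have beta_gt0 : 0 < beta by exact: lt_trans theta_lt_beta.
have s0 : 0 < s by rewrite divr_gt0.
have s1 : s < 1 by rewrite ltr_pdivrMr// mul1r.
have [K K0 KP] := @three_lines R Y s (introT andP (conj s0 s1)).
have [cX cX0 DXc] := Delta_bounded hX; have [cY cY0 DYc] := Delta_bounded hY.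
have mX A (mA : measurable A) : linear (DeltaX A) := Delta_linear hX mA.
have mY A (mA : measurable A) : linear (DeltaY A) := Delta_linear hY mA.
have [i_bdd i_small] := i_ac.
have transfer A (mA : measurable A) := interpolation_transfer
  (mX A mA) (mY A mA) cX0 cY0 (DXc A ^~ mA) (DYc A ^~ mA) (i_Delta A ^~ mA)
  theta_gt0 theta_lt_beta beta_lt1 KP.
split.
  (* Boundedness of the inclusion is the same estimate for [A = setT], where [DeltaY] is the
     identity; without smallness to achieve, both exponent parameters are 0. *)
  have [c c0 ic] : exists2 c : R, 0 <= c & forall f, rnorm (i f) <= c * rnorm f.
    have [_ _] := i_bdd.
    move: (fun c => @rnorm_le_op_norm _ _ _ _ c i_bdd).
    case: (op_norm _ _ _) => [r| |] // rP _.
      exists `|r| => // f; apply: (le_trans (rP r (lexx _) f)).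
      by rewrite ler_wpM2r ?rnorm_ge0// ler_norm.
    by exists 0 => // f; apply: rP; exact: leNye.
  have ic' f : rnorm (i (DeltaX setT f)) <= c * rnorm f.
    by rewrite (Delta_setT hX) ic.
  pose S := Num.max (((2 - beta) / 2) ^+ 1 * cX)
    ((2 - beta) ^+ 1 * (K * (c * (1 + s) ^+ 0 + cY * ((1 + s) / 2) ^+ 0))).
  have S0 : 0 <= S.
    by rewrite le_max mulr_ge0 ?(ltW cX0)// exprn_ge0// divr_ge0//; lra.
  have idE : id = DeltaY setT.
    by apply/funext => f; rewrite (Delta_setT hY).
  have [|D_bdd _] := @interpolation_op_norm_le _ _ _ i (DeltaY setT) theta beta S
    (mY _ measurableT) S0; last by rewrite idE.
  apply: (@transfer c S 0%N 0%N _ measurableT) => //.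
    by rewrite le_max lexx.
  by rewrite le_max lexx orbT.
move=> eps eps0.
(* Order of choice: [k] from [eps], then [m], then [e], then [delta]. The Re z = 1 bound is
   [eps / 8 + eps / 8], so [S = eps / 4], doubled to [eps / 2] by [interpolation_op_norm_le]. *)
have [k kP] : exists k, cX * ((2 - beta) / 2) ^+ k <= eps / 4.
  apply: exists_geometric_le; last by rewrite divr_gt0.
  by apply/andP; split; lra.
pose B := (2 - beta) ^+ k.+1 * K.
have B0 : 0 < B by rewrite mulr_gt0// exprn_gt0//; lra.
have [m mP] : exists m, B * cY * ((1 + s) / 2) ^+ m <= eps / 8.
  apply: exists_geometric_le; last by rewrite divr_gt0.
  by apply/andP; split; lra.
pose e := eps / 8 / (B * (1 + s) ^+ m).
have e0 : 0 < e by rewrite !divr_gt0// mulr_gt0// exprn_gt0//; lra.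
have [delta delta0 deltaP] := i_small e e0.
exists delta => // A mA muA; have [iA_bdd iA_lt] := deltaP A mA muA.
have iAe := rnorm_le_op_norm iA_bdd (ltW iA_lt).
have S0 : 0 <= eps / 4 by rewrite divr_ge0// ltW.
have [] := @interpolation_op_norm_le _ _ _ i (DeltaY A) theta beta (eps / 4)
  (mY _ mA) S0.
  apply: (@transfer e (eps / 4) k m _ mA) => //; last exact: ltW.
    rewrite mulrC exprS; apply: le_trans kP; rewrite ler_wpM2l ?(ltW cX0)//.
    by rewrite ler_piMl ?exprn_ge0//; lra.
  rewrite -/s [leLHS](_ : _ = e * (B * (1 + s) ^+ m) +
    B * cY * ((1 + s) / 2) ^+ m); last by rewrite /B; ring.
  have -> : e * (B * (1 + s) ^+ m) = eps / 8.
    by rewrite /e divfK// gt_eqF// mulr_gt0// exprn_gt0//; lra.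
  by apply: (le_trans (lerD (lexx _) mP)); lra.
move=> A_bdd A_le; split=> //; apply: le_lt_trans A_le _.
by rewrite lte_fin; lra.
Qed.
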